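(* Let $\Pi$ be the Hamming-distance conditional encryption construction described in the context, with message space $\Sigma^n$ and predicate $P_{\ell,\mathsf{Ham}}$, where $P_{\ell,\mathsf{Ham}}(m_1,m_2)=1$ if and only if $\mathsf{Ham}(m_1,m_2)\le\ell$. Assume that the underlying authenticated encryption scheme $(\mathsf{Auth.Enc},\mathsf{Auth.Dec})$ is $(t_{AE},\epsilon_{AE}(t_{AE},\lambda))$-secure for any security parameter $\lambda$ and any running time parameter $t_{AE}$. Then for any $t$ and any security parameter $\lambda$, $\Pi$ provides $(t,t_{\mathsf{Sim}},\epsilon(t,\lambda))$-conditional encryption secrecy with $$\epsilon(t,\lambda)\le\epsilon_{AE}(t,\lambda)+2^{-\lambda}\quad\text{and}\quad t_{\mathsf{Sim}}=n\cdot t_{\mathsf{P.Enc}}+\mathrm{poly}(\lambda),$$ where $t_{\mathsf{P.Enc}}$ is the time of one Paillier encryption.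
   Context: **Conditional encryption.** For a binary predicate $P:\mathcal M\times\mathcal M\to\{0,1\}$, a conditional encryption scheme consists of algorithms $(\mathsf{KeyGen},\mathsf{Enc},\mathsf{CondEnc},\mathsf{Dec})$: $(sk,pk)=\mathsf{KeyGen}(1^\lambda;r)$; $\mathsf{Enc}_{pk}(m_1;r)$ outputs a ciphertext with flag $0$; $\mathsf{CondEnc}_{pk}(c,m_2,m_3;r)$ takes a regular (flag $0$) ciphertext, a control message $m_2$ and a payload message $m_3$ and outputs a ciphertext with flag $1$ (and outputs $\bot$ if the input ciphertext has flag $1$); $\mathsf{Dec}_{sk}$ outputs a message in $\mathcal M$ or $\bot$. *Conditional encryption secrecy.* The scheme provides $(t,t_{\mathsf{Sim}},\epsilon)$-conditional encryption secrecy if there is a simulator $\mathsf{Sim}$ running in time at most $t_{\mathsf{Sim}}(\lambda)$ such that for all $m_1,m_2,m_3\in\mathcal M$ with $P(m_1,m_2)=0$, all $\lambda$, all coins $r,r_1$, and all distinguishers $\mathcal D$ running in time at most $t(\lambda)$, with $(sk,pk)=\mathsf{KeyGen}(1^\lambda;r)$ and $c_1=\mathsf{Enc}_{pk}(m_1;r_1)$, $$\big|\Pr[\mathcal D(sk,pk,m_1,m_2,m_3,c_1,\mathsf{Sim}(pk))=1]-\Pr[\mathcal D(sk,pk,m_1,m_2,m_3,c_1,\mathsf{CondEnc}_{pk}(c_1,m_2,m_3))=1]\big|\le\epsilon(t(\lambda),\lambda),$$ probabilities over the coins of $\mathcal D$, $\mathsf{Sim}$ and $\mathsf{CondEnc}$.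 **Paillier.** Public key $(N,g)$, $N=pq$ with $p,q$ distinct primes, $\gcd(N,(p-1)(q-1))=1$, $g=N+1$; encryption of $m\in\mathbb Z_N$ with nonce $r\in\mathbb Z_N^*$: $\mathsf{P.Enc}_{pk}(m;r)=g^mr^N\bmod N^2$; decryption $\mathsf{P.Dec}_{sk}(c)$ of $c\in\mathbb Z_{N^2}^*$ returns the unique $m\in\mathbb Z_N$ such that $c=g^mr^N\bmod N^2$ for some $r\in\mathbb Z_N^*$, computed from the factorization of $N$. **Secret sharing.** $\mathsf{ShareGen}(n,t,s)$ is Shamir secret sharing over the field $\mathbb F_{2^\lambda}$ ($n+1\le 2^\lambda$), producing shares $s_1,\dots,s_n\in\mathbb F_{2^\lambda}$ (identified with integers in $\{0,\dots,2^\lambda-1\}$): any $t$ shares determine $s$ through $\mathsf{SecretRecover}$ (interpolation), and any $t-1$ shares are uniform and independent of $s$. **Authenticated encryption.** A symmetric-key scheme with keys in $\{0,1\}^\lambda$ and $\mathsf{Auth.Dec}_K(\mathsf{Auth.Enc}_K(m))=m$; payload ciphertexts have a fixed length $l(\lambda)$. It is $(t_{AE},\epsilon_{AE}(t_{AE},\lambda))$-secure if for every message $m$, any distinguisher running in time at most $t_{AE}$ distinguishes $\mathsf{Auth.Enc}_K(m)$, for uniform $K\in\{0,1\}^\lambda$, from a uniformly random string in $\{0,1\}^{l(\lambda)}$ with advantage at most $\epsilon_{AE}(t_{AE},\lambda)$ (distinguishers are non-uniform, i.e. may have fixed inputs hardwired). **The Hamming construction.** $\Sigma$ is a finite alphabet,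 $m[i]$ is the $i$th character of $m\in\Sigma^n$, $\mathsf{Ham}(m_1,m_2)=|\{i:m_1[i]\ne m_2[i]\}|$, $0\le\ell<n$. $\mathsf{ToInt}:\Sigma\to\{0,\dots,|\Sigma|-1\}$ is a bijection (characters are identified with their images). - $\mathsf{KeyGen}$: Paillier key generation with $\min\{p,q\}\ge|\Sigma|$, $\gcd(N,(p-1)(q-1))=1$ and $N\ge 2n2^{2\lambda}$. - $\mathsf{Enc}_{pk}(m)=(0,c[1],\dots,c[n])$ with $c[i]=\mathsf{P.Enc}_{pk}(\mathsf{ToInt}(m[i]);r_i)$, independent uniform $r_i\in\mathbb Z_N^*$. - $\mathsf{CondEnc}_{pk}((b,c_1[1],\dots,c_1[n]),m_2,m_3)$: if $b=1$ output $\bot$. Otherwise pick uniform $K\in\{0,1\}^\lambda$, compute $c_{AE}=\mathsf{Auth.Enc}_K(m_3)$ and shares $(s_1,\dots,s_n)\leftarrow\mathsf{ShareGen}(n,n-\ell,K)$. For each $i$ let $x_i=\mathsf{REnc}(s_i)=a_i2^\lambda+s_i$ with $a_i$ uniform in $\{0,\dots,\lfloor (N-1-s_i)/2^\lambda\rfloor\}$, pick uniform $R_i\in\mathbb Z_N$, $r_i\in\mathbb Z_N^*$, and set $c[i]=c_1[i]^{R_i}(N+1)^{-R_i\mathsf{ToInt}(m_2[i])+x_i}r_i^N\bmod N^2$. Output $(1,c[1],\dots,c[n],c_{AE})$. - $\mathsf{Dec}_{sk}$: for flag $0$, decrypt character by character. For flag $1$, compute $s_i'=\mathsf{P.Dec}_{sk}(c[i])\bmod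 2^\lambda$; for each $S\subseteq[n]$ with $|S|=n-\ell$ compute $K_S=\mathsf{SecretRecover}(\{(i,s_i')\}_{i\in S})$ and, if $\mathsf{Auth.Dec}_{K_S}(c_{AE})\ne\bot$, return this value; if all subsets fail return $\bot$. *)

(* Defs.v *)
From HB Require Import structures.
From mathcomp Require Import all_boot all_order all_algebra.
From mathcomp Require Import reals.

Set Implicit Arguments.
Unset Strict Implicit.
Unset Printing Implicit Defensive.

Import Order.TTheory GRing.Theory Num.Theory.

(* A finite tree of independent uniform choices; every finType sampled below
   is nonempty. *)
Inductive rcomp (A : Type) : Type :=
| Ret of A
| Unif (T : finType) of (T -> rcomp A).

Fixpoint rbind (A B : Type) (m : rcomp A) (k : A -> rcomp B) : rcomp B :=
  match m with
  | Ret a => k a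
  | Unif T f => Unif (fun x : T => rbind (f x) k)
  end.

Definition runif (T : finType) : rcomp T := Unif (fun x : T => Ret x).

Declare Scope rcomp_scope.
Delimit Scope rcomp_scope with rcomp.
Notation "x <-- m ;; k" := (rbind m (fun x => k))
  (at level 100, m at next level, right associativity) : rcomp_scope.

Fixpoint prob (R : realType) (A : Type) (E : A -> bool) (m : rcomp A) : R :=
  match m with
  | Ret a => (E a)%:R
  | Unif T f => ((\sum_(x : T) prob R E (f x)) / #|T|%:R)%R
  end.

Fixpoint always (A : Type) (P : A -> Prop) (m : rcomp A) : Prop :=
  match m with
  | Ret a => P a
  | Unif T f => forall x : T, always P (f x)
  end.

(* Binary notation, least significant bit first, without leading zeros. *)
Definition nat_bits (k : nat) : seq bool :=
  mkseq (fun i => odd (k %/ 2 ^ i)) (up_log 2 k.+1).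

Definition bits_nat (s : seq bool) : nat :=
  foldr (fun (b : bool) v => b + v.*2) 0 s.

(* The residues modulo N coprime to N, i.e. Z_N^*. *)
Definition unitZ (N : nat) : finType := {r : 'I_N | coprime N r}.

Definition store := nat -> seq bool.

Definition upd (s : store) (x : nat) (v : seq bool) : store :=
  fun y => if y == x then v else s y.

(* The inputs occupy the first registers, the advice the remaining ones. *)
Definition load (advice : store) (inputs : seq (seq bool)) : store :=
  fun i => nth (advice (i - size inputs)) inputs i.

Definition no_advice : store := fun _ => [::].

(* Registers hold bit strings, used as stacks. [Call x p args] runs [p] in a
   fresh store on the contents of [args] and puts its register 0 into [x].
   Exact uniform sampling from Z_N and Z_N^* is primitive, since it cannot be
   achieved in bounded time with coin flips. *)
Inductive prog : Type :=
| Skip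
| Push of bool & nat
| Pop of nat
| Copy of nat & nat
| Coin of nat
| Rand of nat & nat
| RandUnit of nat & nat
| Seq of prog & prog
| If of nat & prog & prog
| While of nat & prog
| Call of nat & prog & seq nat.

Fixpoint prog_size (p : prog) : nat :=
  match p with
  | Seq p q | If _ p q => (prog_size p + prog_size q).+1
  | While _ p => (prog_size p).+1
  | Call _ p args => (prog_size p + size args).+1
  | _ => 1
  end.

Definition outcome := rcomp (option (nat * store)).

Definition tick (c k : nat) (next : nat -> outcome) : outcome :=
  if c <= k then next (k - c) else Ret None.

Definition obindr (m : outcome) (next : nat -> store -> outcome) : outcome :=
  rbind m (fun o => if o is Some (k, s) then next k s else Ret None).

(* [exec p k s] runs [p] with time budget [k]; a run ends in [Some (k', s')]
   where [k'] is the unused time, or in [None] if the budget is exhausted.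
   Elementary steps on stack tops cost 1, the operations that handle whole
   strings are charged their lengths. The fuel of the loop is harmless: an
   iteration consumes at least one unit of the budget. *)
Fixpoint exec (p : prog) (k : nat) (s : store) {struct p} : outcome :=
  match p with
  | Skip => tick 1 k (fun k => Ret (Some (k, s)))
  | Push b x => tick 1 k (fun k => Ret (Some (k, upd s x (b :: s x))))
  | Pop x => tick 1 k (fun k => Ret (Some (k, upd s x (behead (s x)))))
  | Copy x y => tick (size (s y)).+1 k (fun k => Ret (Some (k, upd s x (s y))))
  | Coin x =>
      tick 1 k (fun k =>
        Unif (fun b : bool => Ret (Some (k, upd s x (b :: s x)))))
  | Rand x y =>
      tick (size (s y)).+1 k (fun k =>
        Unif (fun z : 'I_(bits_nat (s y)).-1.+1 =>
          Ret (Some (k, upd s x (nat_bits z)))))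
  | RandUnit x y =>
      tick (size (s y)).+1 k (fun k =>
        Unif (fun z : unitZ (bits_nat (s y)).-1.+1 =>
          Ret (Some (k, upd s x (nat_bits (val z))))))
  | Seq p q => obindr (exec p k s) (exec q)
  | If x p q =>
      tick 1 k (fun k => if head false (s x) then exec p k s else exec q k s)
  | While x p =>
      let fix loop (fuel k : nat) (s : store) {struct fuel} : outcome :=
        tick 1 k (fun k =>
          if s x is [::] then Ret (Some (k, s))
          else if fuel is fuel'.+1 then obindr (exec p k s) (loop fuel')
          else Ret None)
      in loop k k s
  | Call x p args =>
      let inputs := [seq s y | y <- args] in
      tick (sumn [seq size v | v <- inputs]).+1 k (fun k =>
        obindr (exec p k (load no_advice inputs)) (fun k s' =>
          tick (size (s' 0)) k (fun k => Ret (Some (k, upd s x (s' 0))))))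
  end.

Definition halts (p : prog) (t : nat) (s : store) : Prop :=
  always (fun o => o <> None) (exec p t s).

Definition computes (p : prog) (t : nat) (inputs : seq (seq bool))
    (output : seq bool) : Prop :=
  always (fun o => exists ks, o = Some ks /\ ks.2 0 = output)
    (exec p t (load no_advice inputs)).

Definition poly_bounded (f : nat -> nat) : Prop :=
  exists c d : nat, forall lam, f lam <= c * lam ^ d + c.

Definition unary_poly_time (l : nat -> nat) : Prop :=
  exists (p : prog) (b : nat -> nat), poly_bounded b /\
    forall lam, computes p (b lam) [:: nseq lam true] (nseq (l lam) true).

(* A distinguisher is non-uniform: a program with hardwired advice. Its time
   bound also bounds the program text, since otherwise a decision tree reading
   its input bit by bit would compute any function in linear time. *)
Definition distinguisher := (prog * store)%type.

Definition time_bounded (D : distinguisher) (t : nat)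
    (inputs : seq (seq bool) -> Prop) : Prop :=
  prog_size D.1 <= t /\ forall v, inputs v -> halts D.1 t (load D.2 v).

(* The output bit is the top of register 0. *)
Definition run_dist (D : distinguisher) (t : nat) (v : seq (seq bool)) :
    rcomp bool :=
  rbind (exec D.1 t (load D.2 v))
    (fun o => Ret (if o is Some (_, s) then head false (s 0) else false)).

Record ae_scheme (M : Type) (lam : nat) := AEScheme {
  ae_len : nat;
  ae_coins : finType;
  ae_coins_gt0 : 0 < #|ae_coins|;
  ae_enc : lam.-tuple bool -> M -> ae_coins -> ae_len.-tuple bool;
  ae_dec : lam.-tuple bool -> ae_len.-tuple bool -> option M;
  ae_decK : forall K m r, ae_dec K (ae_enc K m r) = Some m
}.

Definition ae_secure (R : realType) (M : Type) (lam : nat)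
    (AE : ae_scheme M lam) (t : nat) (eps : R) : Prop :=
  forall (m : M) (D : distinguisher),
    time_bounded D t
      (fun v => exists c : (ae_len AE).-tuple bool, v = [:: tval c]) ->
    (`| prob R id (K <-- runif {: lam.-tuple bool} ;;
                   r <-- runif (ae_coins AE) ;;
                   run_dist D t [:: tval (ae_enc K m r)])%rcomp
      - prob R id (c <-- runif {: (ae_len AE).-tuple bool} ;;
                   run_dist D t [:: tval c])%rcomp | <= eps)%R.

(* The [_wire] fields serialize the objects into register contents.
   [ce_ct_width] is the number of registers of a ciphertext, and [ce_param]
   the set of security parameters for which the scheme is defined. *)
Record cond_enc_scheme := CondEncScheme {
  ce_param : nat -> bool;
  ce_msg : Type;
  ce_sk : Type;
  ce_pk : Type;
  ce_ct : nat -> ce_pk -> Type;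
  ce_keygen_coins : nat -> Type;
  ce_enc_coins : ce_pk -> Type;
  ce_keygen : forall lam, ce_keygen_coins lam -> ce_sk * ce_pk;
  ce_enc : forall lam (pk : ce_pk), ce_msg -> ce_enc_coins pk -> ce_ct lam pk;
  ce_condenc : forall lam (pk : ce_pk),
    ce_ct lam pk -> ce_msg -> ce_msg -> rcomp (option (ce_ct lam pk));
  ce_dec : forall lam (pk : ce_pk), ce_sk -> ce_ct lam pk -> option ce_msg;
  ce_ct_width : nat;
  ce_msg_wire : ce_msg -> seq (seq bool);
  ce_sk_wire : ce_sk -> seq (seq bool);
  ce_pk_wire : ce_pk -> seq (seq bool);
  ce_ct_wire : forall lam (pk : ce_pk), ce_ct lam pk -> seq (seq bool)
}.

Section Secrecy.
Variables (R : realType) (Pi : cond_enc_scheme).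
Variable P : ce_msg Pi -> ce_msg Pi -> bool.

(* The challenge [ct] is given in serialized form. *)
Definition ce_view lam (sk : ce_sk Pi) (pk : ce_pk Pi) (m1 m2 m3 : ce_msg Pi)
    (c1 : ce_ct lam pk) (ct : seq (seq bool)) : seq (seq bool) :=
  ct ++ ce_ct_wire c1 ++ ce_pk_wire pk ++ ce_sk_wire sk
     ++ ce_msg_wire m1 ++ ce_msg_wire m2 ++ ce_msg_wire m3.

Definition ce_input lam (v : seq (seq bool)) : Prop :=
  exists (rk : ce_keygen_coins Pi lam) (m1 m2 m3 : ce_msg Pi)
         (c1 c : ce_ct lam (ce_keygen rk).2),
    v = ce_view (ce_keygen rk).1 m1 m2 m3 c1 (ce_ct_wire c).

Definition sim_store lam (pk : ce_pk Pi) : store :=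
  load no_advice (nseq lam true :: ce_pk_wire pk).

(* The simulator leaves its ciphertext in the first registers. *)
Definition run_sim (Sim : prog) (t lam : nat) (pk : ce_pk Pi) :
    rcomp (seq (seq bool)) :=
  rbind (exec Sim t (sim_store lam pk))
    (fun o => Ret (if o is Some (_, s) then mkseq s (ce_ct_width Pi)
                   else [::])).

(* The simulator is one uniform program for all security parameters; the
   distinguishers are arbitrary non-uniform ones, chosen last. *)
Definition cond_enc_secrecy (t tSim : nat -> nat) (eps : nat -> nat -> R) :
    Prop :=
  exists Sim : prog, forall lam, ce_param Pi lam ->
    prog_size Sim <= tSim lam /\
    (forall rk : ce_keygen_coins Pi lam,
      halts Sim (tSim lam) (sim_store lam (ce_keygen rk).2)) /\
    forall m1 m2 m3 : ce_msg Pi, P m1 m2 = false ->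
    forall (rk : ce_keygen_coins Pi lam)
           (r1 : ce_enc_coins (ce_keygen rk).2) (D : distinguisher),
    time_bounded D (t lam) (ce_input lam) ->
    let sk := (ce_keygen rk).1 in
    let pk := (ce_keygen rk).2 in
    let c1 := ce_enc lam m1 r1 in
    (`| prob R id (ct <-- run_sim Sim (tSim lam) lam pk ;;
                   run_dist D (t lam) (ce_view sk m1 m2 m3 c1 ct))%rcomp
      - prob R id (c <-- ce_condenc c1 m2 m3 ;;
                   run_dist D (t lam) (ce_view sk m1 m2 m3 c1
                     (oapp (@ce_ct_wire Pi lam pk) [::] c)))%rcomp |
     <= eps (t lam) lam)%R.

End Secrecy.

Definition paillier_enc (N g m : nat) (r : unitZ N) : 'Z_(N ^ 2) :=
  (g%:R ^+ m * (val r : nat)%:R ^+ N)%R.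

(* The message is specified rather than computed; it is unique on Paillier
   moduli. *)
Definition paillier_dec (sk : nat * nat) (c : nat) : option nat :=
  let N := sk.1 * sk.2 in
  omap (@nat_of_ord N)
    [pick m : 'I_N | [exists r : unitZ N, paillier_enc N.+1 m r == c :> nat]].

(* [kg_size] expresses that an efficient key generation outputs keys of
   polynomial length. *)
Record paillier_keygen (sigma n : nat) := PaillierKeygen {
  kg_coins : nat -> Type;
  kg_primes : forall lam, kg_coins lam -> nat * nat;
  kg_spec : forall lam (r : kg_coins lam),
    let: (p, q) := kg_primes r in
    [/\ prime p, prime q & p != q] /\
    [/\ coprime (p * q) (p.-1 * q.-1), sigma <= minn p q
      & 2 * n * 2 ^ (2 * lam) <= p * q];
  kg_size : exists b, poly_bounded b /\
    forall lam (r : kg_coins lam),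
      size (nat_bits ((kg_primes r).1 * (kg_primes r).2)) <= b lam
}.

(* A field with 2^lam elements identified with {0, ..., 2^lam - 1}. There is
   no such field for lam = 0, hence the guards. *)
Record gf2 (lam : nat) := GF2 {
  gf_sort :> finFieldType;
  gf_int : gf_sort -> nat;
  gf_of : nat -> gf_sort;
  gf_int_lt : 0 < lam -> forall x, gf_int x < 2 ^ lam;
  gf_intK : 0 < lam -> cancel gf_int gf_of;
  gf_ofK : 0 < lam -> forall k, k < 2 ^ lam -> gf_int (gf_of k) = k;
  gf_of0 : 0 < lam -> gf_of 0 = 0%R
}.

Section Shamir.
Variables (lam : nat) (F : gf2 lam) (n : nat).

(* The i-th share, with i ranging over {1, ..., n}, is the value at i. *)
Definition share_point (i : 'I_n) : F := gf_of F i.+1.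

Definition share_gen (t : nat) (s : F) : rcomp {ffun 'I_n -> F} :=
  (a <-- runif {ffun 'I_t.-1 -> F} ;;
   Ret [ffun i : 'I_n =>
     s + \sum_(j < t.-1) a j * share_point i ^+ j.+1]%R)%rcomp.

Definition secret_recover (S : {set 'I_n}) (s : 'I_n -> F) : F :=
  (\sum_(i in S) s i *
     \prod_(j in S :\ i) (share_point j / (share_point j - share_point i)))%R.

End Shamir.

Definition int_of_key lam (K : lam.-tuple bool) : nat := bits_nat K.

Definition key_of_int lam (k : nat) : lam.-tuple bool :=
  [tuple odd (k %/ 2 ^ i) | i < lam].

(* [Reg] is flag 0 and [Cond] is flag 1. *)
Inductive ham_ct (n N l : nat) : Type :=
| Reg of {ffun 'I_n -> 'Z_(N ^ 2)}
| Cond of {ffun 'I_n -> 'Z_(N ^ 2)} & l.-tuple bool.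

Definition ham_ct_wire n N l (c : ham_ct n N l) : seq (seq bool) :=
  match c with
  | Reg cs =>
      [:: [::]; [:: false]] ++ [seq nat_bits (cs i) | i <- enum 'I_n]
  | Cond cs y =>
      [:: tval y; [:: true]] ++ [seq nat_bits (cs i) | i <- enum 'I_n]
  end.

Definition Ham (Sigma : finType) n (m1 m2 : n.-tuple Sigma) : nat :=
  #|[set i : 'I_n | tnth m1 i != tnth m2 i]|.

Definition P_Ham (Sigma : finType) n (ell : nat) (m1 m2 : n.-tuple Sigma) :
    bool :=
  Ham m1 m2 <= ell.

Section Hamming.
Variables (Sigma : finType) (n ell : nat).
Variable toInt : Sigma -> 'I_#|Sigma|.
Variable GF : forall lam, gf2 lam.
Variable KG : paillier_keygen #|Sigma| n.
Variable AE : forall lam, ae_scheme (n.-tuple Sigma) lam.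

Let msg := n.-tuple Sigma.
Let pkey := (nat * nat)%type.
Let skey := (nat * nat)%type.
Let ct lam (pk : pkey) := ham_ct n pk.1 (ae_len (AE lam)).

Definition ham_keygen lam (r : kg_coins KG lam) : skey * pkey :=
  let: (p, q) := kg_primes r in ((p, q), (p * q, (p * q).+1)).

Definition ham_enc lam (pk : pkey) (m : msg) (r : {ffun 'I_n -> unitZ pk.1}) :
    ct lam pk :=
  Reg _ [ffun i => paillier_enc pk.2 (toInt (tnth m i)) (r i)].

Definition ham_condenc lam (pk : pkey) (c : ct lam pk) (m2 m3 : msg) :
    rcomp (option (ct lam pk)) :=
  let N := pk.1 in
  match c with
  | Cond _ _ => Ret None
  | Reg c1 =>
     (K <-- runif {: lam.-tuple bool} ;;
      rAE <-- runif (ae_coins (AE lam)) ;;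
      sh <-- share_gen n (n - ell) (gf_of (GF lam) (int_of_key K)) ;;
      let s i := gf_int (sh i) in
      a <-- runif {dffun forall i : 'I_n, 'I_((N - 1 - s i) %/ 2 ^ lam).+1} ;;
      let x i : nat := a i * 2 ^ lam + s i in
      Rs <-- runif {ffun 'I_n -> 'I_N} ;;
      r <-- runif {ffun 'I_n -> unitZ N} ;;
      Ret (Some (Cond
        [ffun i => (c1 i ^+ Rs i
             * (N.+1)%:R ^ (- (Rs i * toInt (tnth m2 i))%N%:Z + (x i)%:Z)
             * (val (r i) : nat)%:R ^+ N)%R]
        (ae_enc K m3 rAE))))%rcomp
  end.

Definition char_of_int (v : nat) : option Sigma :=
  [pick a : Sigma | toInt a == v :> nat].

Definition ham_dec lam (pk : pkey) (sk : skey) (c : ct lam pk) : option msg :=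
  match c with
  | Reg cs =>
      let ds := [ffun i => obind char_of_int (paillier_dec sk (cs i))] in
      [pick m : msg | [forall i, ds i == Some (tnth m i)]]
  | Cond cs y =>
      let s i := gf_of (GF lam) (odflt 0 (paillier_dec sk (cs i)) %% 2 ^ lam) in
      ohead (pmap
        (fun S => ae_dec (key_of_int lam (gf_int (secret_recover S s))) y)
        (enum [set S : {set 'I_n} | #|S| == n - ell]))
  end.

Definition hamming_scheme : cond_enc_scheme := {|
  ce_param := fun lam => n.+1 <= 2 ^ lam;
  ce_msg := msg;
  ce_sk := skey;
  ce_pk := pkey;
  ce_ct := ct;
  ce_keygen_coins := kg_coins KG;
  ce_enc_coins := fun pk => {ffun 'I_n -> unitZ pk.1};
  ce_keygen := ham_keygen;
  ce_enc := ham_enc;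
  ce_condenc := ham_condenc;
  ce_dec := ham_dec;
  ce_ct_width := n.+2;
  ce_msg_wire := fun m => [seq nat_bits (toInt a) | a <- tval m];
  ce_sk_wire := fun sk => [:: nat_bits sk.1; nat_bits sk.2];
  ce_pk_wire := fun pk => [:: nat_bits pk.1; nat_bits pk.2];
  ce_ct_wire := fun lam pk => @ham_ct_wire n pk.1 (ae_len (AE lam))
|}.

(* The nonce is an argument: drawing it is a separate sampling step. *)
Definition paillier_enc_time (Q : prog) (tPEnc : nat -> nat) : Prop :=
  forall lam (rk : kg_coins KG lam),
    let N := (ham_keygen rk).2.1 in
    let g := (ham_keygen rk).2.2 in
    forall (m : 'I_N) (r : unitZ N),
      computes Q (tPEnc lam)
        [:: nat_bits N; nat_bits g; nat_bits m; nat_bits (val r)]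
        (nat_bits (paillier_enc g m r)).

End Hamming.

(* Main.v *)
Require Import Defs.
From mathcomp Require Import all_boot all_order all_algebra.
From mathcomp Require Import reals.
From mathcomp Require Import zify ring.
From Stdlib Require Import FunctionalExtensionality.

Set Implicit Arguments.
Unset Strict Implicit.
Unset Printing Implicit Defensive.

Import Order.TTheory GRing.Theory Num.Theory.

(* The simulator outputs n encryptions of uniform messages together with a
   uniform string in place of the payload ciphertext.

   A position of the real ciphertext is g^(R (m1 - m2) + x) r^N, up to the
   distribution of the nonce. Where m1 and m2 differ, m1 - m2 is invertible
   modulo N because it is smaller than both primes, so the uniform R makes the
   plaintext uniform. Where they agree, the plaintext is the padded share x;
   there are fewer such positions than the threshold, so the shares involved
   are uniform and independent of K. The padding of a uniform share is at
   distance at most 1/(2 n 2^lam) from uniform on Z_N, and a telescoping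
   argument sums these distances over the positions. This makes the n
   plaintexts uniform and independent of K at the cost of 2^-lam. What
   remains is to replace the authenticated encryption under the uniform key K
   by a uniform string: as the challenge is the first register of the
   distinguisher, all its other inputs can be hardwired as advice, without
   changing the program or its running time. *)

(** * Runs of the machine *)

Lemma bits_nat_mkseq k m :
  bits_nat (mkseq (fun i => odd (k %/ 2 ^ i)) m) = k %% 2 ^ m.
Proof.
elim: m k => [|m IHm] k; first by rewrite modn1.
rewrite /mkseq /= -[1]/(1 + 0) iotaDl -map_comp.
rewrite (eq_map (g := fun i => odd (k %/ 2 %/ 2 ^ i))); last first.
  by move=> i /=; rewrite add1n expnS divnMA.
rewrite -/(mkseq _ _) IHm divn1 expnS.
have := divn_eq (k %/ 2) (2 ^ m).
have kE := divn_eq k 2; rewrite modn2 in kE.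
set q := k %/ 2 %/ _; set r := (k %/ 2) %% _ => qE.
have rlt : r < 2 ^ m by rewrite ltn_pmod // expn_gt0.
have -> : k = q * (2 * 2 ^ m) + (odd k + r.*2) by lia.
rewrite modnMDl modn_small; last by case: (odd k); lia.
congr (nat_of_bool _ + _); lia.
Qed.

Lemma nat_bitsK : cancel nat_bits bits_nat.
Proof.
by move=> k; rewrite bits_nat_mkseq modn_small // up_logP.
Qed.

Lemma size_nat_bits k : size (nat_bits k) = up_log 2 k.+1.
Proof. exact: size_mkseq. Qed.

Lemma size_nat_bits_le k m : k < 2 ^ m -> size (nat_bits k) <= m.
Proof. by rewrite size_nat_bits => /up_log_min -> . Qed.

Lemma size_nat_bits_homo k m : k <= m -> size (nat_bits k) <= size (nat_bits m).
Proof. by move=> km; rewrite !size_nat_bits leq_up_log. Qed.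

Lemma ltn_size_nat_bits k : k < 2 ^ size (nat_bits k).
Proof. by rewrite size_nat_bits up_logP. Qed.

Lemma bits_nat_lt v : bits_nat v < 2 ^ size v.
Proof. by elim: v => //= b v IHv; rewrite expnS; case: b; lia. Qed.

(** The range [.-1.+1] keeps [Rand] nonempty on the modulus [0]; a sample still fits in the length
    of the modulus, for which [Rand] is charged. *)
Lemma size_nat_bits_sample v k :
  k < (bits_nat v).-1.+1 -> size (nat_bits k) <= size v.
Proof.
move=> kv; apply: size_nat_bits_le.
by apply: leq_ltn_trans (bits_nat_lt v); lia.
Qed.

(** [always] is vacuous on a choice from an empty type; this predicate guarantees that at least one
    outcome exists. *)
Fixpoint nonempty_choices A (m : rcomp A) : Prop :=
  match m with
  | Ret _ => True
  | Unif T f => 0 < #|T| /\ forall x : T, nonempty_choices (f x)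
  end.

Lemma nonempty_bind A B (m : rcomp A) (k : A -> rcomp B) :
  nonempty_choices m -> (forall a, nonempty_choices (k a)) ->
  nonempty_choices (rbind m k).
Proof.
elim: m => [a|T f IH] //= [T0 pf] pk.
by split=> // x; apply: IH.
Qed.

Lemma always_bind A B (P : A -> Prop) (P' : B -> Prop) (m : rcomp A)
    (k : A -> rcomp B) :
  always P m -> (forall a, P a -> always P' (k a)) -> always P' (rbind m k).
Proof.
elim: m => [a|T f IH] /= Pm Pk; first exact: Pk.
by move=> x; apply: IH.
Qed.

Lemma always_impl A (P P' : A -> Prop) (m : rcomp A) :
  (forall a, P a -> P' a) -> always P m -> always P' m.
Proof.
move=> PP'; elim: m => [a|T f IH] /=; first exact: PP'.
by move=> Pf x; apply: IH.
Qed.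

(** Names the fixpoint hidden in [exec], with fuel and budget as separate arguments so that
    inductions can run on the fuel alone. *)
Definition while_loop (x : nat) (body : nat -> store -> outcome) :=
  fix loop (fuel k : nat) (s : store) {struct fuel} : outcome :=
    tick 1 k (fun k =>
      if s x is [::] then Ret (Some (k, s))
      else if fuel is fuel'.+1 then obindr (body k s) (loop fuel')
      else Ret None).

Lemma exec_while x p k s :
  exec (While x p) k s = while_loop x (exec p) k k s.
Proof. by []. Qed.

Lemma while_loopE x body fuel k s :
  while_loop x body fuel k s = tick 1 k (fun k =>
      if s x is [::] then Ret (Some (k, s))
      else if fuel is fuel'.+1 then obindr (body k s) (while_loop x body fuel')
      else Ret None).
Proof. by case: fuel. Qed.

Lemma card_unitZ_gt0 N : 0 < N -> 0 < #|unitZ N|.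
Proof.
case: N => // N _; apply/card_gt0P.
have c1 : coprime N.+1 (inord (1 %% N.+1) : 'I_N.+1).
  by rewrite inordK ?ltn_pmod // coprime_modr coprimen1.
by exists (exist (fun r : 'I_N.+1 => coprime N.+1 r) _ c1 : unitZ N.+1).
Qed.

Lemma exec_nonempty p k s : nonempty_choices (exec p k s).
Proof.
have tickP c k0 next : (forall k', nonempty_choices (next k')) ->
    nonempty_choices (tick c k0 next).
  by rewrite /tick; case: leqP.
have bindP m next : nonempty_choices m ->
    (forall k' s', nonempty_choices (next k' s')) ->
    nonempty_choices (obindr m next).
  by move=> pm pn; apply: nonempty_bind => // -[[k' s']|].
elim: p k s => [|b x|x|x y|x|x y|x y|p IHp q IHq|x p IHp q IHq|x p IHp|
  x p IHp args] k s;
    rewrite ?exec_while /=.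
- exact: (tickP).
- exact: (tickP).
- exact: (tickP).
- exact: (tickP).
- by apply: (tickP) => k' /=; rewrite card_bool.
- by apply: (tickP) => k' /=; rewrite card_ord.
- by apply: (tickP) => k' /=; split=> //; apply: card_unitZ_gt0.
- exact: (bindP).
- by apply: (tickP) => k'; case: ifP.
- move: {1}k => fuel; elim: fuel k s => [|fuel IH] k s; rewrite while_loopE;
    apply: (tickP) => k' /=; case: (s x) => // *; exact: (bindP).
- by apply: (tickP) => k'; apply: (bindP) => // k'' s''; apply: (tickP).
Qed.

Definition grows_by_time (M k : nat) (o : option (nat * store)) : Prop :=
  if o is Some (k', s') then
    k' <= k /\ forall i, size (s' i) + k' <= M + k
  else True.

Lemma size_upd M s x v : (forall i, size (s i) <= M) -> size v <= M ->
  forall i, size (upd s x v i) <= M.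
Proof. by move=> sM vM i; rewrite /upd; case: eqP. Qed.

Lemma exec_size M p k s :
  (forall i, size (s i) <= M) -> always (grows_by_time M k) (exec p k s).
Proof.
have tickP M' c k0 next :
    (forall k', k' + c = k0 -> always (grows_by_time (M' + c) k') (next k')) ->
    always (grows_by_time M' k0) (tick c k0 next).
  rewrite /tick; case: leqP => //= ck /(_ (k0 - c)) H.
  apply: always_impl (H _); last lia.
  by move=> -[[k' s']|] //= [? Hs]; split=> [|i]; [|have := Hs i]; lia.
have retP M' k0 (s' : store) : (forall i, size (s' i) <= M') ->
    grows_by_time M' k0 (Some (k0, s')).
  by move=> H /=; split=> // i; rewrite leq_add2r.
have bindP M' k0 m next : always (grows_by_time M' k0) m ->
    (forall k' s' M'', k' <= k0 -> (forall i, size (s' i) <= M'') ->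
      always (grows_by_time M'' k') (next k' s')) ->
    always (grows_by_time M' k0) (obindr m next).
  move=> Hm Hn; apply: always_bind Hm _ => -[[k' s']|] //= [k'k Hs].
  apply: always_impl (Hn _ _ (M' + (k0 - k')) k'k _) => [[[k'' s'']|]|] //=.
    by move=> [? H]; split=> [|i]; [|have := H i]; lia.
  by move=> i; have := Hs i; lia.
have updS M' c (s' : store) x v : (forall i, size (s' i) <= M') ->
    size v <= M' + c -> forall i, size (upd s' x v i) <= M' + c.
  by move=> Hs; apply: size_upd => i; apply: leq_trans (Hs i) _; lia.
elim: p M k s => [|b x|x|x y|x|x y|x y|p IHp q IHq|x p IHp q IHq|x p IHp|
  x p IHp args] M k s sM;
    rewrite ?exec_while /=.
- by apply: (tickP) => k' _; apply: (retP) => i; have := sM i; lia.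
- by apply: (tickP) => k' _; apply: (retP); apply: (updS) => //=; have := sM x; lia.
- apply: (tickP) => k' _; apply: (retP); apply: (updS) => //.
  by rewrite size_behead; have := sM x; lia.
- by apply: (tickP) => k' _; apply: (retP); apply: (updS) => //; have := sM y; lia.
- apply: (tickP) => k' _ b; apply: (retP); apply: (updS) => //=.
  by have := sM x; lia.
- apply: (tickP) => k' _ z; apply: (retP); apply: (updS) => //.
  by have := size_nat_bits_sample (ltn_ord z); lia.
- apply: (tickP) => k' _ z; apply: (retP); apply: (updS) => //.
  by apply: leq_trans (size_nat_bits_sample (ltn_ord _)) _; lia.
- by apply: (bindP); [apply: IHp | move=> *; apply: IHq].
- apply: (tickP) => k' _; case: ifP => _; [apply: IHp|apply: IHq] => i;
    have := sM i; lia.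
(* Any fuel will do: running out of it gives [None], on which the invariant imposes nothing. *)
- move: {2}k => fuel; elim: fuel M k s sM => [|fuel IH] M k s sM;
    rewrite while_loopE; apply: (tickP) => k' _ /=;
    have sM' i : size (s i) <= M + 1 by rewrite (leq_trans (sM i)) ?leq_addr.
  + by case: (s x) => //=; apply: (retP).
  + case: (s x) => [|_ _] //=; first exact: retP.
    by apply: (bindP) => *; [apply: IHp|apply: IH].
- apply: (tickP) => k' _.
  set c := (sumn _).+1.
  have lM i : size (load no_advice [seq s y | y <- args] i) <= M + c.
    rewrite /load; have [il|il] := ltnP i (size [seq s y | y <- args]).
      rewrite (set_nth_default [::]) //.
      by have /mapP[y _ ->] := mem_nth [::] il; have := sM y; lia.
    by rewrite nth_default.
  apply: always_bind (IHp _ _ _ lM) _ => -[[k2 s2]|] //= [k2k Hs].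
  rewrite /tick; case: leqP => //= s2k.
  split=> [|i]; first lia.
  by rewrite /upd; case: eqP => _; [have := Hs 0|have := sM i]; lia.
Qed.

(** Compares a run with the one that starts with [d] more units of time: the same choices, [d] more
    units left over. An exhausted run may continue in any way. *)
Inductive budget_ext (d : nat) : outcome -> outcome -> Prop :=
| BudgetExtNone m : budget_ext d (Ret None) m
| BudgetExtSome k s : budget_ext d (Ret (Some (k, s))) (Ret (Some (k + d, s)))
| BudgetExtUnif (T : finType) (f g : T -> outcome) :
    (forall x, budget_ext d (f x) (g x)) -> budget_ext d (Unif f) (Unif g).

Lemma budget_ext_bind d m m' h h' :
  budget_ext d m m' ->
  (forall k s, budget_ext d (h k s) (h' (k + d) s)) ->
  budget_ext d (obindr m h) (obindr m' h').
Proof.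
move=> mm' hh'; elim: mm' => [m''|k s|T f g _ IH]; first exact: BudgetExtNone.
  exact: hh'.
exact: BudgetExtUnif.
Qed.

Lemma exec_budget_ext d p k s : budget_ext d (exec p k s) (exec p (k + d) s).
Proof.
have tickP c k0 h h' : (forall k', budget_ext d (h k') (h' (k' + d))) ->
    budget_ext d (tick c k0 h) (tick c (k0 + d) h').
  move=> hh'; rewrite /tick; case: leqP => ck; last exact: BudgetExtNone.
  by rewrite (leq_trans ck (leq_addr _ _)) -addnBAC.
have retP k0 s0 := BudgetExtSome d k0 s0.
elim: p k s => [|b x|x|x y|x|x y|x y|p IHp q IHq|x p IHp q IHq|x p IHp|
  x p IHp args] k s;
    rewrite ?exec_while /=.
1-4: exact: tickP.
1-3: by apply: (tickP) => k' /=; apply: BudgetExtUnif.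
- exact: budget_ext_bind.
- by apply: (tickP) => k'; case: ifP.
(* The larger budget also means more fuel; this inequality is all that the induction needs to know
   of the two fuels. *)
- have : k <= k + d by rewrite leq_addr.
  move: {1 2}k {1 2}(k + d) => fuel fuel'.
  elim: fuel fuel' k s => [|fuel IH] [|fuel'] k s // le_ff';
    rewrite !while_loopE; apply: (tickP) => k' /=; case: (s x) => //= _ _;
    first exact: BudgetExtNone; first exact: BudgetExtNone.
  by apply: budget_ext_bind => // k2 s2; apply: IH.
- apply: (tickP) => k'; apply: budget_ext_bind => // k2 s2; exact: tickP.
Qed.

(* [refines Post m mu]: the run [m] never exceeds its budget, and its final
   states can be coupled with the ideal experiment [mu] so that [Post] holds;
   [m] may make additional random choices. *)
Inductive refines A (Post : A -> nat -> store -> Prop) :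
    outcome -> rcomp A -> Prop :=
| RefinesRet a k s : Post a k s -> refines Post (Ret (Some (k, s))) (Ret a)
| RefinesSkip (T : finType) f mu : 0 < #|T| ->
    (forall x : T, refines Post (f x) mu) -> refines Post (Unif f) mu
| RefinesUnif (T : finType) f g : 0 < #|T| ->
    (forall x : T, refines Post (f x) (g x)) ->
    refines Post (Unif f) (Unif g).

Lemma refines_bind A B (Post : A -> nat -> store -> Prop)
    (Post' : B -> nat -> store -> Prop) m mu h g :
  refines Post m mu ->
  (forall a k s, Post a k s -> refines Post' (h k s) (g a)) ->
  refines Post' (obindr m h) (rbind mu g).
Proof.
move=> mP hP; elim: mP => [a k s /hP|T f mu0 T0 _ IH|T f f' T0 _ IH] //=.
  exact: RefinesSkip.
exact: RefinesUnif.
Qed.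

Lemma refines_impl A (Post Post' : A -> nat -> store -> Prop) m mu :
  (forall a k s, Post a k s -> Post' a k s) ->
  refines Post m mu -> refines Post' m mu.
Proof.
move=> PP'; elim=> [a k s /PP' asP|T f mu0 T0 _ IH|T f f' T0 _ IH].
- exact: RefinesRet.
- exact: RefinesSkip.
- exact: RefinesUnif.
Qed.

Lemma refines_always A (Post : A -> nat -> store -> Prop) m mu :
  refines Post m mu -> always (fun o => o <> None) m.
Proof. by elim. Qed.

(** When every outcome satisfies [P], the internal coins of the run can all be absorbed as
    additional choices over the trivial experiment. *)
Lemma budget_ext_refines d m m' (P : store -> Prop) :
  budget_ext d m m' -> nonempty_choices m ->
  always (fun o => exists ks, o = Some ks /\ P ks.2) m ->
  refines (fun (_ : unit) k s => d <= k /\ P s) m' (Ret tt).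
Proof.
elim=> [m0 _ [? []]|k s _ [ks [[<-] Ps]]|T f g _ IH /= [T0 pf] af] //.
  by apply: RefinesRet; rewrite leq_addl.
by apply: RefinesSkip => // x; apply: IH.
Qed.

(** A Hoare triple with cost: quantifying over all sufficient budgets and bounding the time consumed
    makes costs add up under [Seq]. *)
Definition spec A (c : nat) (p : prog) (s : store) (mu : rcomp A)
    (Post : A -> store -> Prop) : Prop :=
  forall k, c <= k ->
    refines (fun a k' s' => k <= k' + c /\ Post a s') (exec p k s) mu.

(** [computes] speaks of the single budget [t]; monotonicity in the budget carries it to every
    larger one. *)
Lemma computes_spec p t inputs output : computes p t inputs output ->
  spec t p (load no_advice inputs) (Ret tt) (fun _ s' => s' 0 = output).
Proof.
move=> p_out k tk.
have := exec_budget_ext (k - t) p t (load no_advice inputs).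
rewrite subnKC // => pk.
have := budget_ext_refines (P := fun s' => s' 0 = output) pk
  (exec_nonempty _ _ _) p_out.
by apply: refines_impl => _ k' s' [? ?]; split=> //; lia.
Qed.

(** Follow one actual run, which exists because choices are nonempty, and apply the growth bound to
    its register 0. *)
Lemma computes_size p t inputs output M : computes p t inputs output ->
  (forall v, v \in inputs -> size v <= M) -> size output <= M + t.
Proof.
move=> p_out in_M.
have lM i : size (load no_advice inputs i) <= M.
  rewrite /load; have [il|il] := ltnP i (size inputs).
    by rewrite (set_nth_default [::]) //; apply/in_M/mem_nth.
  by rewrite nth_default.
have := exec_size p t lM; move: p_out (exec_nonempty p t (load no_advice inputs)).
rewrite /computes; elim: (exec _ _ _) => [o|T f IH] /=.
  by move=> [[k s'] [-> /= <-]] _ [_ /(_ 0)]; apply/leq_trans/leq_addr.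
by move=> outf [/card_gt0P[x _] pf] szf; apply: (IH x).
Qed.

(** * Cost rules for instructions, sequences, calls and the coin loop *)

Lemma spec_impl A c c' p s (mu : rcomp A) (Post Post' : A -> store -> Prop) :
  c <= c' -> (forall a s', Post a s' -> Post' a s') ->
  spec c p s mu Post -> spec c' p s mu Post'.
Proof.
move=> cc' PP' sp k c'k; apply: refines_impl (sp k (leq_trans cc' c'k)).
by move=> a k' s' [? /PP']; split=> //; lia.
Qed.

Lemma spec_copy x y s v : s y = v ->
  spec (size v).+1 (Copy x y) s (Ret tt) (fun _ s' => s' = upd s x v).
Proof.
move=> <- k ck; rewrite /= /tick ck; apply: RefinesRet; split=> //; lia.
Qed.

Lemma spec_push b x s :
  spec 1 (Push b x) s (Ret tt) (fun _ s' => s' = upd s x (b :: s x)).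
Proof.
move=> k ck; rewrite /= /tick ck; apply: RefinesRet; split=> //; lia.
Qed.

Lemma spec_le A c c' p s (mu : rcomp A) (Post : A -> store -> Prop) :
  c <= c' -> spec c p s mu Post -> spec c' p s mu Post.
Proof. by move=> cc'; apply: spec_impl. Qed.

Lemma spec_map A B (f : A -> B) c p s (mu : rcomp A)
    (Post : A -> store -> Prop) (Post' : B -> store -> Prop) :
  (forall a s', Post a s' -> Post' (f a) s') ->
  spec c p s mu Post -> spec c p s (rbind mu (fun a => Ret (f a))) Post'.
Proof.
move=> PP' sp k /sp; elim=> [a k' s' [? /PP' ?]|T g mu' T0 _ IH|T g g' T0 _ IH].
- exact: RefinesRet.
- exact: RefinesSkip.
- exact: RefinesUnif.
Qed.

Lemma spec_seq A B c1 c2 p q s (mu : rcomp A) (nu : A -> rcomp B)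
    (Post1 : A -> store -> Prop) (Post2 : B -> store -> Prop) :
  spec c1 p s mu Post1 ->
  (forall a s', Post1 a s' -> spec c2 q s' (nu a) Post2) ->
  spec (c1 + c2) (Seq p q) s (rbind mu nu) Post2.
Proof.
move=> sp sq k ck /=.
apply: refines_bind (sp k _) _; first lia.
move=> a k' s' [kk' /sq sq']; apply: refines_impl (sq' k' _); last lia.
by move=> b k'' s'' [? ?]; split=> //; lia.
Qed.

Lemma spec_seq_det A c1 c2 p q s (mu : rcomp A)
    (Post1 : unit -> store -> Prop) (Post2 : A -> store -> Prop) :
  spec c1 p s (Ret tt) Post1 ->
  (forall s', Post1 tt s' -> spec c2 q s' mu Post2) ->
  spec (c1 + c2) (Seq p q) s mu Post2.
Proof. by move=> sp sq; apply: (spec_seq (nu := fun _ => mu) sp) => -[]. Qed.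

Lemma spec_rand x y s N : s y = nat_bits N -> 0 < N ->
  spec (size (nat_bits N)).+1 (Rand x y) s (runif 'I_N)
    (fun z s' => s' = upd s x (nat_bits z)).
Proof.
move=> sy N0 k ck; rewrite /= sy /tick ck nat_bitsK prednK //.
apply: RefinesUnif => [|z]; first by rewrite card_ord.
by apply: RefinesRet; split=> //; lia.
Qed.

Lemma spec_rand_unit x y s N : s y = nat_bits N -> 0 < N ->
  spec (size (nat_bits N)).+1 (RandUnit x y) s (runif (unitZ N))
    (fun z s' => s' = upd s x (nat_bits (val z))).
Proof.
move=> sy N0 k ck; rewrite /= sy /tick ck nat_bitsK prednK //.
apply: RefinesUnif => [|z]; first exact: card_unitZ_gt0.
by apply: RefinesRet; split=> //; lia.
Qed.

Lemma spec_call A (a : A) x p t args s output :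
  computes p t [seq s y | y <- args] output ->
  spec ((sumn [seq size (s y) | y <- args]).+1 + t + size output)
    (Call x p args) s (Ret a) (fun a' s' => a' = a /\ s' = upd s x output).
Proof.
have <- : [seq size v | v <- [seq s y | y <- args]] = [seq size (s y) | y <- args].
  by rewrite -map_comp.
move=> /computes_spec sp k ck /=; move: (sumn _) ck => cost ck.
rewrite /tick; case: ifP => [ck'|]; last lia.
apply: (refines_bind (g := fun _ => Ret a)) (sp _ _) _; first lia.
move=> [] k' s' [kk' ->]; case: leqP => [|]; last lia.
by move=> ?; apply: RefinesRet; split=> //; lia.
Qed.

Fixpoint coin_flips (m : nat) (acc : seq bool) : rcomp (seq bool) :=
  if m is m'.+1 then Unif (fun b : bool => coin_flips m' (b :: acc))
  else Ret acc.

Lemma spec_coin_flips (x y : nat) (s : store) : x != y ->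
  spec (3 * size (s x)).+1 (While x (Seq (Pop x) (Coin y))) s
    (coin_flips (size (s x)) (s y))
    (fun v s' => s' y = v /\ forall i, i != x -> i != y -> s' i = s i).
Proof.
move=> xy k; rewrite exec_while => ck.
have : size (s x) <= k by lia.
(* The fuel only has to cover the bits still to be consumed. An iteration costs 3: the test, [Pop]
   and [Coin]. *)
move: {1 3}k => fuel.
elim: fuel k s ck => [|fuel IH] k s ck; rewrite while_loopE /tick;
  (case: ifP => [k0|]; last lia); case sx: (s x) ck => [|b v] //= ck.
1,2: by move=> *; apply: RefinesRet; split=> //; lia.
rewrite ltnS => vfuel; rewrite /tick.
case: ifP => [k1|]; last lia.
rewrite /obindr /=; case: ifP => [k2|]; last lia.
apply: RefinesUnif => [|b']; first by rewrite card_bool.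
have := IH (k - 1 - 1 - 1) (upd (upd s x v) y (b' :: s y)).
rewrite /upd sx /= eqxx (eq_sym y) (negPf xy) eqxx /=.
move=> /(_ _ vfuel) H; apply: refines_impl (H _); last lia.
move=> w k' s' [kk' [s'y s'i]]; split; first lia; split=> // i ix iy.
by rewrite s'i // (negPf ix) (negPf iy).
Qed.

(** * The simulator *)

Fixpoint iid A (m : nat) (mu : rcomp A) : rcomp (seq A) :=
  if m is m'.+1 then rbind mu (fun a => rbind (iid m' mu) (fun xs => Ret (a :: xs)))
  else Ret [::].

Definition paillier_sample N : rcomp ('I_N * unitZ N) :=
  rbind (runif 'I_N) (fun m => rbind (runif (unitZ N)) (fun r => Ret (m, r))).

Definition paillier_wire N (mr : 'I_N * unitZ N) : seq bool :=
  nat_bits (paillier_enc N.+1 mr.1 mr.2).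

Section Simulator.
Variables (p Q : prog) (n : nat).

(* Registers: [n + 2] holds N, [n + 3] holds g, [n + 4] the unary length of the
   payload ciphertext, [n + 5] and [n + 6] message and nonce, [n + 7] is empty. *)
Definition enc_prog (j : nat) : prog :=
  Seq (Rand n.+4.+1 n.+2) (Seq (RandUnit n.+4.+2 n.+2)
    (Call j Q [:: n.+2; n.+3; n.+4.+1; n.+4.+2])).

Fixpoint encs_prog (m j : nat) : prog :=
  if m is m'.+1 then Seq (enc_prog j) (encs_prog m' j.+1) else Skip.

(** The key is moved away before outputs overwrite registers 1 and 2. Copying from the empty
    register clears a register, and the unary length serves as counter for the coin flips. *)
Definition sim_prog : prog :=
  Seq (Copy n.+2 1) (Seq (Copy n.+3 2) (Seq (Call n.+4 p [:: 0])
  (Seq (Copy 0 n.+4.+3) (Seq (While n.+4 (Seq (Pop n.+4) (Coin 0)))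
  (Seq (Copy 1 n.+4.+3) (Seq (Push true 1) (encs_prog n 2))))))).

Section Key.
Variables (N tQ : nat).
Hypothesis N_gt1 : 1 < N.
Hypothesis Q_enc : forall (m : 'I_N) (r : unitZ N),
  computes Q tQ [:: nat_bits N; nat_bits N.+1; nat_bits m; nat_bits (val r)]
    (nat_bits (paillier_enc N.+1 m r)).

Let S := size (nat_bits N).

Definition key_loaded (s : store) : Prop :=
  s n.+2 = nat_bits N /\ s n.+3 = nat_bits N.+1.

Lemma size_bits_key : size (nat_bits N.+1) <= S.+1.
Proof.
apply: size_nat_bits_le; rewrite expnS.
by have := ltn_size_nat_bits N; rewrite -/S; lia.
Qed.

Lemma size_paillier_wire mr : size (paillier_wire (N := N) mr) <= 2 * S.
Proof.
apply: size_nat_bits_le; apply: (@leq_trans (N ^ 2)).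
  by rewrite -[X in _ < X]Zp_cast; [exact: ltn_ord | rewrite -(exp1n 2) ltn_exp2r].
by rewrite mulnC expnM leq_sqr ltnW // ltn_size_nat_bits.
Qed.

Lemma enc_prog_spec j s : j < n.+2 -> key_loaded s ->
  spec (tQ + (8 * S + 5)) (enc_prog j) s (paillier_sample N)
    (fun mr s' => s' j = paillier_wire mr /\
       forall i, i < n.+4 -> i != j -> s' i = s i).
Proof.
move=> jn [sN sg]; have N0 := ltnW N_gt1.
(* Two samplings at [S + 1] each, then a call that transfers at most [4 * S + 1] bits of arguments
   and [2 * S] bits of ciphertext. *)
apply: (@spec_le _ (S.+1 + (S.+1 + (tQ + (6 * S + 3))))); first lia.
apply: spec_seq; first exact: (spec_rand _ sN N0).
move=> m s1 s1E.
have s1N : s1 n.+2 = nat_bits N by rewrite s1E /upd ifN //; lia.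
apply: spec_seq; first exact: (spec_rand_unit _ s1N N0).
move=> r s2 s2E.
have args : [seq s2 y | y <- [:: n.+2; n.+3; n.+4.+1; n.+4.+2]] =
    [:: nat_bits N; nat_bits N.+1; nat_bits m; nat_bits (val r)].
  rewrite /= s2E s1E /upd.
  by repeat (case: eqP => ?; try (exfalso; lia)); rewrite sN sg.
have := Q_enc m r; rewrite -args => Q_out.
have := spec_call (m, r) j Q_out.
apply: spec_impl.
  have -> : [seq size (s2 y) | y <- [:: n.+2; n.+3; n.+4.+1; n.+4.+2]] =
    [seq size v | v <- [seq s2 y | y <- [:: n.+2; n.+3; n.+4.+1; n.+4.+2]]] by [].
  rewrite args /= -/S; have := size_paillier_wire (m, r); have := size_bits_key.
  have mS : size (nat_bits m) <= S by apply: size_nat_bits_homo; apply: ltnW.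
  have rS : size (nat_bits (val r)) <= S.
    by apply: size_nat_bits_homo; apply: ltnW.
  rewrite /paillier_wire; move: (nat_bits (paillier_enc _ _ _)) => w.
  by move: (size _) rS => rsize; lia.
move=> _ s' [-> ->]; split=> [|i ik ij]; rewrite /upd ?eqxx //.
rewrite (negPf ij) s2E s1E /upd.
by repeat (case: eqP => ?; try (exfalso; lia)).
Qed.

Lemma encs_prog_spec m j s : j + m <= n.+2 -> key_loaded s ->
  spec (m * tQ + (m * (8 * S + 5) + 1)) (encs_prog m j) s
    (iid m (paillier_sample N))
    (fun mrs s' => mkseq (fun i => s' (j + i)) m = map (@paillier_wire N) mrs /\
      forall i, i < j -> s' i = s i).
Proof.
elim: m j s => [|m IH] j s jn sN.
  move=> k k0; rewrite /= /tick; case: ifP => [_|]; last lia.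
  by apply: RefinesRet; split=> //; lia.
apply: (@spec_le _ (tQ + (8 * S + 5) + (m * tQ + (m * (8 * S + 5) + 1))));
  first lia.
apply: spec_seq; first by apply: enc_prog_spec => //; lia.
move=> mr s1 [s1j s1i].
have s1N : key_loaded s1 by rewrite /key_loaded !s1i //; lia.
apply: spec_map (IH j.+1 s1 _ s1N); last lia.
move=> mrs s2 [s2E s2i]; split; last by move=> i ij; rewrite s2i ?s1i //; lia.
rewrite /= -s2E /mkseq /= addn0 s2i // s1j; congr (_ :: _).
rewrite (iotaDl 1 0) -map_comp; apply: eq_map => i /=; congr (s2 _); lia.
Qed.

Variables (lam b l : nat).
Hypothesis n_gt0 : 0 < n.
Hypothesis p_len : computes p b [:: nseq lam true] (nseq l true).

Lemma sim_prog_spec :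
  spec (n * tQ + (n * (8 * S + 5) + (2 * S + 5 * lam + 5 * b + 20)))
    sim_prog (load no_advice [:: nseq lam true; nat_bits N; nat_bits N.+1])
    (rbind (coin_flips l [::]) (fun y =>
       rbind (iid n (paillier_sample N)) (fun mrs =>
         Ret (y :: [:: true] :: map (@paillier_wire N) mrs))))
    (fun v s' => mkseq s' n.+2 = v).
Proof.
(* The payload length is controlled only through the time needed to write it in unary. *)
have l_le : l <= lam + b.
  have := computes_size (M := lam) p_len; rewrite size_nseq; apply => v.
  by rewrite inE => /eqP ->; rewrite size_nseq.
set s0 := load _ _.
have s0i i : 2 < i -> s0 i = [::].
  by move=> i2; rewrite /s0 /load nth_default //= leqNgt; apply/negP; lia.
set c0 := n * tQ + (n * (8 * S + 5) + 1).
apply: (@spec_le _ (S.+1 + (S.+2 + ((lam.+1 + b + l) + (1 + ((3 * l).+1 +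
   (1 + (1 + c0)))))))); first by rewrite /c0; lia.

have upd_neq (s : store) i x v : i != x -> upd s x v i = s i.
  by rewrite /upd => /negPf ->.
have upd_eq (s : store) x v : upd s x v x = v by rewrite /upd eqxx.
apply: spec_seq_det; first exact: (@spec_copy _ _ _ (nat_bits N)).
move=> s1 s1E.
apply: spec_seq_det.
  apply: (@spec_le _ (size (nat_bits N.+1)).+1); first exact: size_bits_key.
  by apply: spec_copy; rewrite s1E upd_neq //; lia.
move=> s2 s2E.
have s2N : key_loaded s2.
  by rewrite /key_loaded s2E upd_eq upd_neq ?s1E ?upd_eq //; lia.
have s2_hi i : n.+3 < i -> s2 i = [::].
  by move=> ni; rewrite s2E s1E !upd_neq ?s0i //; lia.
have p_out : computes p b [seq s2 y | y <- [:: 0]] (nseq l true).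
  by rewrite /= s2E s1E !upd_neq.
apply: spec_seq_det.
  apply: spec_le (spec_call tt n.+4 p_out).
  by rewrite /= !size_nseq s2E s1E !upd_neq // size_nseq; lia.
move=> s3 [_ s3E].
apply: spec_seq_det.
  by apply: (@spec_copy _ _ _ [::]); rewrite s3E upd_neq ?s2_hi //; lia.
move=> s4 s4E.
have s4n : s4 n.+4 = nseq l true by rewrite s4E upd_neq // s3E upd_eq.
have s4_0 : s4 0 = [::] by rewrite s4E upd_eq.
apply: spec_seq.
  have := @spec_coin_flips n.+4 0 s4 isT.
  by rewrite s4n s4_0 size_nseq; apply.
move=> y s5 [s5_0 s5E].
apply: spec_seq_det.
  apply: (@spec_copy _ _ _ [::]).
  by rewrite s5E ?s4E ?s3E ?upd_neq ?s2_hi //; lia.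
move=> s6 s6E.
apply: spec_seq_det; first exact: spec_push.
move=> s7 s7E.
have s7_1 : s7 1 = [:: true] by rewrite s7E upd_eq s6E upd_eq.
have s7_0 : s7 0 = y by rewrite s7E s6E !upd_neq.
have s7N : key_loaded s7.
  by rewrite /key_loaded s7E s6E !upd_neq // !s5E ?s4E ?s3E ?upd_neq //; lia.
apply: spec_map (encs_prog_spec _ s7N); last lia.
move=> mrs s8 [<- s8E]; rewrite /mkseq /= !s8E // s7_0 s7_1; congr [:: _, _ & _].
by rewrite (iotaDl 2 0) -map_comp; apply: eq_map.
Qed.
End Key.
End Simulator.

(** * Averages and statistical distance *)

Local Open Scope ring_scope.

Section Expectation.
Variable R : realType.
Implicit Types (A B : Type) (T U : finType).

Definition avg T (f : T -> R) : R := (\sum_x f x) / #|T|%:R.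

(** Extends [prob] from events to real-valued tests, so that nested experiments can be averaged out
    one at a time. *)
Fixpoint Ex A (g : A -> R) (m : rcomp A) : R :=
  match m with
  | Ret a => g a
  | Unif T f => avg (fun x : T => Ex g (f x))
  end.

Lemma eq_avg T (f g : T -> R) : f =1 g -> avg f = avg g.
Proof. by move=> fg; rewrite /avg (eq_bigr g). Qed.

Lemma prob_bind A B (E : B -> bool) (m : rcomp A) (k : A -> rcomp B) :
  prob R E (rbind m k) = Ex (fun a => prob R E (k a)) m.
Proof. by elim: m => //= T f IH; apply: (eq_avg IH). Qed.

Lemma Ex_bind A B (g : B -> R) (m : rcomp A) (k : A -> rcomp B) :
  Ex g (rbind m k) = Ex (fun a => Ex g (k a)) m.
Proof. by elim: m => //= T f IH; apply: eq_avg. Qed.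

Lemma Ex_runif T B (g : B -> R) (k : T -> rcomp B) :
  Ex g (rbind (runif T) k) = avg (fun x => Ex g (k x)).
Proof. by []. Qed.

Lemma eq_Ex A (g h : A -> R) (m : rcomp A) : g =1 h -> Ex g m = Ex h m.
Proof. by move=> gh; elim: m => //= T f IH; apply: eq_avg. Qed.

Lemma avg_const T (c : R) : (0 < #|T|)%N -> avg (fun _ : T => c) = c.
Proof.
move=> T0; rewrite /avg sumr_const -[_ *+ _]mulr_natr mulfK //.
by rewrite pnatr_eq0 -lt0n.
Qed.

Lemma avg_itv T (f : T -> R) :
  (forall x, 0 <= f x <= 1) -> 0 <= avg f <= 1.
Proof.
move=> f01; rewrite /avg divr_ge0 ?sumr_ge0 //=; last first.
  by move=> x _; case/andP: (f01 x).
(* Over an empty type the average is [0], because the inverse of [0] is [0]. *)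
have [->|T0] := posnP #|T|; first by rewrite invr0 mulr0 ler01.
rewrite ler_pdivrMr ?ltr0n // mul1r -sum1_card natr_sum.
by apply: ler_sum => x _; case/andP: (f01 x).
Qed.

Lemma prob_itv A (E : A -> bool) (m : rcomp A) : 0 <= prob R E m <= 1.
Proof.
elim: m => [a|T f IH] /=; last exact: avg_itv.
by case: (E a); rewrite ?lexx ?ler01.
Qed.

Lemma avg_dist T (f g : T -> R) e : (0 < #|T|)%N ->
  (forall x, `|f x - g x| <= e) -> `|avg f - avg g| <= e.
Proof.
move=> T0 fg; rewrite /avg -mulrBl -sumrB normrM [`|_^-1|]ger0_norm ?invr_ge0 //.
rewrite ler_pdivrMr ?ltr0n // (le_trans (ler_norm_sum _ _ _)) //.
rewrite (le_trans (ler_sum _ (fun x _ => fg x))) //.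
by rewrite sumr_const mulr_natr.
Qed.

Lemma avg_exchange T U (F : T -> U -> R) :
  avg (fun x => avg (F x)) = avg (fun y => avg (fun x => F x y)).
Proof. by rewrite /avg -!mulr_suml exchange_big mulrAC. Qed.

Lemma avg_pair T U (F : T * U -> R) :
  avg F = avg (fun x => avg (fun y => F (x, y))).
Proof.
rewrite /avg -mulr_suml -mulrA -invfM -natrM mulnC -card_prod pair_bigA.
by congr (_ / _); apply: eq_bigr => -[].
Qed.

Lemma avg_bij T U (h : T -> U) (F : U -> R) : bijective h ->
  avg F = avg (fun x => F (h x)).
Proof.
move=> hb; rewrite /avg (bij_eq_card hb) (reindex h) //.
exact: onW_bij.
Qed.

Lemma avg_prod (I T : finType) (v : I -> T -> R) :
  avg (fun b : {ffun I -> T} => \prod_i v i (b i)) = \prod_i avg (v i).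
Proof.
by rewrite /avg -bigA_distr_bigA card_ffun natrX -prodr_const prodf_div.
Qed.

(** The additional choices of the run average a constant over a nonempty type, hence leave the
    expectation unchanged. *)
Lemma Ex_refines A (Post : A -> nat -> store -> Prop) m mu
    (h : option (nat * store) -> R) (g : A -> R) :
  refines Post m mu ->
  (forall a k s, Post a k s -> h (Some (k, s)) = g a) -> Ex h m = Ex g mu.
Proof.
move=> mP hg; elim: mP => [a k s /hg|T f mu0 T0 _ IH|T f f' T0 _ IH] //=.
  by rewrite (eq_avg IH) avg_const.
exact: eq_avg.
Qed.

Lemma avg_tupleS T m (F : m.+1.-tuple T -> R) :
  avg F = avg (fun x => avg (fun t : m.-tuple T => F [tuple of x :: t])).
Proof.
rewrite (@avg_bij _ _ (fun xt : T * m.-tuple T => [tuple of xt.1 :: xt.2])).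
  by rewrite avg_pair.
exists (fun t => (thead t, [tuple of behead t])) => [[x t]|t].
  by rewrite /= theadE; congr pair; apply: val_inj.
by rewrite -tuple_eta.
Qed.

Lemma avg_tuple0 T (F : 0.-tuple T -> R) : avg F = F [tuple].
Proof.
rewrite -[RHS](@avg_const (0.-tuple T)) ?card_tuple //.
by apply: eq_avg => t; rewrite tuple0.
Qed.

Lemma Ex_iid T (mu : rcomp T) m (g : seq T -> R) :
  (forall h, Ex h mu = avg h) ->
  Ex g (iid m mu) = avg (fun t : m.-tuple T => g t).
Proof.
move=> muE; elim: m g => [|m IH] g /=; first by rewrite avg_tuple0.
rewrite Ex_bind muE avg_tupleS; apply: eq_avg => x.
by rewrite Ex_bind IH.
Qed.

(** Pushing the flips reverses their order; reversal is a bijection, so the string is still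
    uniform. *)
Lemma Ex_coin_flips l (g : seq bool -> R) :
  Ex g (coin_flips l [::]) = avg (fun t : l.-tuple bool => g t).
Proof.
have flipsE acc : Ex g (coin_flips l acc) =
    avg (fun t : l.-tuple bool => g (rev t ++ acc)).
  elim: l acc => [|l IH] acc /=; first by rewrite avg_tuple0.
  rewrite avg_tupleS; apply: eq_avg => b; rewrite IH; apply: eq_avg => t.
  by rewrite /= rev_cons cat_rcons.
rewrite flipsE (@avg_bij _ _ (fun t : l.-tuple bool => [tuple of rev t])).
  by apply: eq_avg => t; rewrite /= revK cats0.
by exists (fun t : l.-tuple bool => [tuple of rev t]) => t; apply: val_inj;
  rewrite /= revK.
Qed.

Lemma avg_tuple_ffun T m (F : {ffun 'I_m -> T} -> R) :
  avg F = avg (fun t : m.-tuple T => F [ffun i => tnth t i]).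
Proof.
apply: avg_bij; exists (fun f : {ffun _ -> _} => [tuple f i | i < m]) => [t|f].
  by apply: eq_from_tnth => i; rewrite tnth_mktuple ffunE.
by apply/ffunP => i; rewrite ffunE tnth_mktuple.
Qed.

Lemma avg_ffun_pair (I : finType) T U (F : {ffun I -> T * U} -> R) :
  avg F = avg (fun f : {ffun I -> T} => avg (fun g : {ffun I -> U} =>
    F [ffun i => (f i, g i)])).
Proof.
rewrite -[RHS](avg_pair (fun fg : {ffun I -> T} * {ffun I -> U} =>
  F [ffun i => (fg.1 i, fg.2 i)])).
apply: avg_bij.
exists (fun h : {ffun I -> T * U} =>
  ([ffun i => (h i).1], [ffun i => (h i).2])) => [[f g]|h].
  by congr pair; apply/ffunP => i; rewrite !ffunE.
by apply/ffunP => i; rewrite !ffunE -surjective_pairing.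
Qed.

Lemma avg_ffun_bij (I : finType) T U (h : I -> T -> U) (F : {ffun I -> U} -> R) :
  (forall i, bijective (h i)) ->
  avg F = avg (fun f : {ffun I -> T} => F [ffun i => h i (f i)]).
Proof.
move=> hb; apply: avg_bij.
have cardTU : (#|{ffun I -> U}| <= #|{ffun I -> T}|)%N.
  rewrite !card_ffun; have [i|I0] := pickP I; first by rewrite (bij_eq_card (hb i)).
  by rewrite (eq_card0 I0) !expn0.
apply: inj_card_bij cardTU => f g /ffunP fg; apply/ffunP => i.
by have := fg i; rewrite !ffunE; apply: bij_inj.
Qed.

(** Subadditivity of the L1 distance on product distributions, by a hybrid argument that exchanges
    one coordinate at a time. *)
Lemma prod_weights_dist n T (P Q : 'I_n -> T -> R) (G : {ffun 'I_n -> T} -> R) :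
  (forall i t, 0 <= P i t) -> (forall i t, 0 <= Q i t) ->
  (forall i, \sum_t P i t = 1) -> (forall i, \sum_t Q i t = 1) ->
  (forall x, 0 <= G x <= 1) ->
  `|\sum_(x : {ffun 'I_n -> T}) (\prod_i P i (x i)) * G x
     - \sum_(x : {ffun 'I_n -> T}) (\prod_i Q i (x i)) * G x|
    <= \sum_i \sum_t `|P i t - Q i t|.
Proof.
move=> P0 Q0 P1 Q1 G01.
(* The [k]th hybrid uses [P] before position [k] and [Q] from there on, so hybrids [k] and [k.+1]
   differ at position [k] only. *)
pose M (k : nat) (i : 'I_n) (t : T) := if (i < k)%N then P i t else Q i t.
pose H k := \sum_(x : {ffun 'I_n -> T}) (\prod_i M k i (x i)) * G x.
have -> : \sum_(x : {ffun 'I_n -> T}) (\prod_i P i (x i)) * G x = H n.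
  apply: eq_bigr => x _; congr (_ * _); apply: eq_bigr => i _.
  by rewrite /M ltn_ord.
have -> : \sum_(x : {ffun 'I_n -> T}) (\prod_i Q i (x i)) * G x = H 0%N by [].
rewrite -telescope_sumr // big_mkord; apply: le_trans (ler_norm_sum _ _ _) _.
apply: ler_sum => k _.
(* Summing the product of the [D i] over all [x] factors by coordinate, and every factor except the
   [k]th is 1. *)
pose D i t := if i == k then `|P i t - Q i t| else M k i t.
have -> : \sum_t `|P k t - Q k t| = \sum_(x : {ffun 'I_n -> T}) \prod_i D i (x i).
  rewrite -bigA_distr_bigA [RHS](bigD1 k) //= [X in _ = _ * X]big1 ?mulr1.
    by apply: eq_bigr => t _; rewrite /D eqxx.
  move=> i ik; rewrite /D (negPf ik) /M.
  by case: (i < k)%N.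
rewrite /H -sumrB; apply: le_trans (ler_norm_sum _ _ _) _.
apply: ler_sum => x _; rewrite -mulrBl normrM.
have -> : \prod_i M k.+1 i (x i) - \prod_i M k i (x i) =
    (P k (x k) - Q k (x k)) * \prod_(i | i != k) M k i (x i).
  rewrite (bigD1 k) //= [X in _ - X](bigD1 k) //= mulrBl /M ltnSn ltnn.
  congr (_ * _ - _); apply: eq_bigr => i ik; rewrite ltnS leq_eqVlt.
  by rewrite -val_eqE /= in ik; rewrite (negPf ik).
have DE : \prod_i D i (x i) =
    `|P k (x k) - Q k (x k)| * \prod_(i | i != k) M k i (x i).
  rewrite (bigD1 k) //= /D eqxx; congr (_ * _).
  by apply: eq_bigr => i ik; rewrite (negPf ik).
rewrite DE normrM -[leRHS]mulr1.
have M0 : 0 <= \prod_(i | i != k) M k i (x i).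
  by apply: prodr_ge0 => i _; rewrite /M; case: ifP.
rewrite [`|\prod_(_ | _) _|]ger0_norm // ler_wpM2l ?mulr_ge0 //.
by case/andP: (G01 x) => G0 G1; rewrite ger0_norm.
Qed.

End Expectation.

(** * Shares and their padding *)

Section Shares.
Variables (R : realType) (lam : nat) (F : gf2 lam) (n : nat).
Hypotheses (lam_gt0 : (0 < lam)%N) (n_lt : (n < 2 ^ lam)%N).

Lemma gf_of_inj k m : (k < 2 ^ lam)%N -> (m < 2 ^ lam)%N ->
  gf_of F k = gf_of F m -> k = m.
Proof. by move=> kl ml e; rewrite -(gf_ofK F lam_gt0 kl) e gf_ofK. Qed.

Lemma card_gf2 : #|F| = (2 ^ lam)%N.
Proof.
rewrite -[RHS]card_ord;
apply: (@bij_eq_card _ _ (fun x : F => Ordinal (@gf_int_lt _ F lam_gt0 x))).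
exists (fun k : 'I_(2 ^ lam) => gf_of F k) => [x|k] /=; first exact: gf_intK.
by apply: val_inj; rewrite /= gf_ofK.
Qed.

Lemma share_point_inj : injective (@share_point lam F n).
Proof.
move=> i j /gf_of_inj ij; apply: val_inj; apply/succn_inj/ij;
  exact: leq_ltn_trans (ltn_ord _) n_lt.
Qed.

Lemma share_point_neq0 (i : 'I_n) : share_point F i != 0.
Proof.
apply/eqP; rewrite -(gf_of0 F lam_gt0) => /gf_of_inj ij.
suff : i.+1 = 0%N by [].
by apply: ij; rewrite ?expn_gt0 //; apply: leq_ltn_trans (ltn_ord i) n_lt.
Qed.

(** If two coefficient vectors give equal shares, the constant terms cancel; after division by the
    nonzero share point, their difference is a polynomial of size at most [k] with [k] distinct
    roots. *)
Lemma share_map_inj k (e : k.-tuple 'I_n) (s : F) : uniq e ->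
  injective (fun a : {ffun 'I_k -> F} => [ffun j =>
    s + \sum_(i < k) a i * share_point F (tnth e j) ^+ i.+1]).
Proof.
move=> ue a b /ffunP ab; apply/ffunP.
pose q := rVpoly (\row_i (a i - b i)).
have qE x : q.[x] = \sum_(i < k) (a i - b i) * x ^+ i.
  by rewrite horner_poly; apply: eq_bigr => i _; rewrite valK mxE.
suff q0 : q = 0.
  move=> i; apply/eqP; rewrite -subr_eq0.
  have := coef_rVpoly_ord (\row_i (a i - b i)) i.
  by rewrite -/q q0 coef0 mxE => <-.
have qroots : all (root q) (map (@share_point _ F n) e).
  apply/allP => _ /mapP[i /tnthP[j ->] ->]; apply/eqP.
  apply: (mulfI (share_point_neq0 (tnth e j))); rewrite mulr0 qE.
  have := ab j; rewrite !ffunE => /addrI/eqP; rewrite -subr_eq0 -sumrB => /eqP.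
  apply: etrans; rewrite mulr_sumr; apply: eq_bigr => i' _.
  by rewrite exprS; ring.
apply/eqP/contraT => /max_poly_roots/(_ qroots).
rewrite (map_inj_uniq share_point_inj) ue size_map size_tuple => /(_ isT).
by rewrite ltnNge size_poly.
Qed.

(* Fewer shares than the threshold are independent and uniform: complete them
   to [t - 1] shares, which determine the random coefficients. *)
Lemma share_gen_indep t (s : F) (M : {set 'I_n}) (u : 'I_n -> F -> R) :
  (#|M| <= t.-1 <= n)%N ->
  Ex (fun sh : {ffun _ -> _} => \prod_(i in M) u i (sh i)) (share_gen n t s) =
  \prod_(i in M) avg (u i).
Proof.
case/andP=> Mt tn; rewrite /share_gen /=; set k := t.-1 in Mt tn *.
pose es := enum M ++ take (k - #|M|) (enum (~: M)).
have es_size : size es == k.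
  rewrite size_cat size_takel -!cardE ?subnKC //.
  by have := cardsC M; rewrite card_ord; lia.
have ue : uniq es.
  rewrite cat_uniq enum_uniq take_uniq ?enum_uniq // andbT.
  apply/hasPn => i /mem_take; rewrite !mem_enum inE; exact: id.
pose e := Tuple es_size.
(* The added positions carry the constant test [1], so they change neither the product nor its
   average. *)
pose v (i : 'I_n) : F -> R := if i \in M then u i else fun _ => 1.
have prodE (w : 'I_n -> R) : (forall i, i \notin M -> w i = 1) ->
    \prod_(i in M) w i = \prod_(j < k) w (tnth e j).
  move=> w1; rewrite -(big_tuple _ _ e xpredT w) /= big_cat /= big_enum /=.
  rewrite [X in _ = _ * X]big1_seq ?mulr1 // => i /andP[_ /mem_take].
  by rewrite mem_enum inE => /w1.
under eq_avg => a.
  rewrite (eq_bigr (fun i => v i ([ffun i => s + \sum_(j < k) a j *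
      share_point F i ^+ j.+1] i))); last by move=> i iM; rewrite /v iM.
  rewrite prodE; last by move=> i iM; rewrite /v (negPf iM).
  under eq_bigr => j _ do rewrite ffunE.
  over.
rewrite [RHS](eq_bigr (fun i => avg (v i))); last by move=> i iM; rewrite /v iM.
rewrite prodE; last first.
  move=> i iM; rewrite /v (negPf iM) avg_const //.
  by rewrite card_gf2 expn_gt0.
rewrite -avg_prod [RHS](avg_bij _ (injF_bij (@share_map_inj _ e s ue))).
by apply: eq_avg => a; apply: eq_bigr => j _; rewrite ffunE.
Qed.

End Shares.

Section Mixing.
Variable R : realType.

Lemma Ex_sumZ A (I : finType) (c : I -> R) (g : I -> A -> R) (m : rcomp A) :
  Ex (fun a => \sum_i c i * g i a) m = \sum_i c i * Ex (g i) m.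
Proof.
elim: m => //= T f IH; rewrite (eq_avg IH) /avg exchange_big mulr_suml /=.
by apply: eq_bigr => i _; rewrite -mulr_sumr mulrA.
Qed.

Definition mix n T (M : {set 'I_n}) (x y : {ffun 'I_n -> T}) : {ffun 'I_n -> T} :=
  [ffun i => if i \in M then x i else y i].

(** The involution [h] swaps the coordinates of [x] and [y] outside [M]. It turns the mixture into
    the first component; the second one then sums to 1. *)
Lemma prod_weights_mix n (T : finType) (M : {set 'I_n}) (P Q : 'I_n -> T -> R)
    (G : {ffun 'I_n -> T} -> R) :
  (forall i, \sum_t P i t = 1) -> (forall i, \sum_t Q i t = 1) ->
  \sum_(x : {ffun 'I_n -> T}) (\prod_i P i (x i)) *
    (\sum_(y : {ffun 'I_n -> T}) (\prod_i Q i (y i)) * G (mix M x y)) =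
  \sum_(x : {ffun 'I_n -> T})
    (\prod_i (if i \in M then P i (x i) else Q i (x i))) * G x.
Proof.
move=> P1 Q1; pose h (xy : {ffun 'I_n -> T} * {ffun 'I_n -> T}) :=
  (mix M xy.1 xy.2, mix M xy.2 xy.1).
have hK : involutive h.
  by case=> x y; rewrite /h /=; congr pair; apply/ffunP => i; rewrite /mix !ffunE;
    case: (i \in M).
under eq_bigr do rewrite mulr_sumr.
rewrite pair_bigA (reindex_inj (inv_inj hK)) /=.
rewrite -(pair_bigA _ (fun x y : {ffun 'I_n -> T} =>
  \prod_i P i (mix M x y i) * (\prod_i Q i (mix M y x i)
    * G (mix M (mix M x y) (mix M y x))))) /=.
apply: eq_bigr => x _.
have mixK y : mix M (mix M x y) (mix M y x) = x := congr1 fst (hK (x, y)).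
under eq_bigr => y _ do rewrite mixK mulrA -big_split /=.
rewrite -mulr_suml; congr (_ * _).
rewrite (eq_bigr (fun y : {ffun 'I_n -> T} => \prod_i
  (if i \in M then P i (x i) * Q i (y i) else P i (y i) * Q i (x i)))); last first.
  by move=> y _; apply: eq_bigr => i _; rewrite /mix !ffunE; case: (i \in M).
rewrite -(bigA_distr_bigA (fun i t =>
  if i \in M then P i (x i) * Q i t else P i t * Q i (x i))).
apply: eq_bigr => i _; case: ifP => _.
  by rewrite -mulr_sumr Q1 mulr1.
by rewrite -mulr_suml P1 mul1r.
Qed.

End Mixing.

(** * Distribution of a padded share *)

Section Padding.
Variables (R : realType) (L N : nat).
Hypotheses (L_gt0 : (0 < L)%N) (L_le_N : (L <= N)%N).

Definition pad_card (s : nat) : nat := ((N - 1 - s) %/ L).+1.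

(** For [x < N], the probability that the share [s] is padded to [x]. *)
Definition pad_weight (s x : nat) : R := (x %% L == s)%N%:R / (pad_card s)%:R.

Lemma pad_lt s (a : 'I_(pad_card s)) : (s < L)%N -> (a * L + s < N)%N.
Proof.
move=> sL; have : (a <= (N - 1 - s) %/ L)%N by rewrite -ltnS.
by rewrite leq_divRL //; lia.
Qed.

Lemma unpad_lt x : (x < N)%N -> (x %/ L < pad_card (x %% L))%N.
Proof.
move=> xN; rewrite ltnS leq_divRL //.
by have := divn_eq x L; lia.
Qed.

(** The range of [a i] depends on the share. Passing to [x = a * L + s], with inverse [x %/ L],
    moves this dependence into weights over the fixed type ['I_N]. *)
Lemma avg_pad n (s : 'I_n -> nat) (H : {ffun 'I_n -> nat} -> R) :
  (forall i, (s i < L)%N) ->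
  avg (fun a : {dffun forall i : 'I_n, 'I_((N - 1 - s i) %/ L).+1} =>
    H [ffun i => (a i * L + s i)%N]) =
  \sum_(x : {ffun 'I_n -> 'I_N}) (\prod_i pad_weight (s i) (x i)) *
    H [ffun i => val (x i)].
Proof.
move=> sL.
pose T := {dffun forall i : 'I_n, 'I_((N - 1 - s i) %/ L).+1}.
pose h (a : T) : {ffun 'I_n -> 'I_N} :=
  [ffun i => Ordinal (@pad_lt _ (a i) (sL i))].
pose h' (x : {ffun 'I_n -> 'I_N}) : T := [ffun i => inord (x i %/ L)].
pose P (x : {ffun 'I_n -> 'I_N}) := [forall i, (x i %% L == s i)%N].
have cardT : (#|T|%:R : R) = \prod_i (pad_card (s i))%:R.
  rewrite -natr_prod; congr (_%:R); rewrite card_dep_ffun foldrE big_image.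
  by apply: eq_bigr => i _; rewrite card_ord.
rewrite (eq_bigr (fun x : {ffun 'I_n -> 'I_N} =>
  if P x then H [ffun i => val (x i)] / #|T|%:R else 0)); last first.
  move=> x _; rewrite /P; case: ifPn => [/forallP xs|/forallPn[i xs]].
    rewrite mulrC cardT; congr (_ * _); rewrite -prodfV.
    by apply: eq_bigr => i _; rewrite /pad_weight xs mul1r.
  by rewrite (bigD1 i) //= /pad_weight (negPf xs) !mul0r.
rewrite -big_mkcond /= -mulr_suml (reindex_onto h h') /=; last first.
  move=> x /forallP xs; apply/ffunP => i; rewrite !ffunE; apply: val_inj => /=.
  rewrite inordK; first by rewrite -(eqP (xs i)) -divn_eq.
  by rewrite -(eqP (xs i)); apply: unpad_lt.
congr (_ / _).
apply: esym; apply: eq_big => [a|a _].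
  apply/andP; split.
    by apply/forallP => i; rewrite ffunE /= modnMDl modn_small.
  apply/eqP/ffunP => i; rewrite !ffunE /=; apply: val_inj => /=.
  by rewrite divnMDl // (divn_small (sL i)) addn0 inordK.
by congr H; apply/ffunP => i; rewrite !ffunE.
Qed.

Lemma pad_weight_ge0 s x : 0 <= pad_weight s x.
Proof. by rewrite divr_ge0. Qed.

Lemma pad_weight_sum s : (s < L)%N -> \sum_(x < N) pad_weight s x = 1.
Proof.
move=> sL; rewrite /pad_weight -mulr_suml.
apply: (canLR (mulfK _)); first by rewrite pnatr_eq0.
rewrite mul1r (eq_bigr (fun x : 'I_N => if (x %% L == s)%N then 1 else 0));
  last first.
  by move=> x _; case: eqP.
rewrite -big_mkcond (reindex_onto (fun a : 'I_(pad_card s) => Ordinal (pad_lt a sL))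
  (fun x : 'I_N => inord (x %/ L))) /=; last first.
  move=> x /eqP xs; apply: val_inj; rewrite /= -xs inordK -?divn_eq //.
  exact: unpad_lt.
rewrite (eq_bigl xpredT) ?sumr_const ?card_ord // => a.
rewrite modnMDl modn_small // eqxx; apply/eqP/val_inj => /=.
by rewrite divnMDl // (divn_small sL) addn0 inordK.
Qed.

Lemma avg_pad_weight x : avg (fun s : 'I_L => pad_weight s x) =
  (L * pad_card (x %% L))%:R^-1.
Proof.
have xL : (x %% L < L)%N by rewrite ltn_pmod.
rewrite /avg card_ord (bigD1 (Ordinal xL)) //= big1 ?addr0.
  by rewrite /pad_weight eqxx mul1r natrM invfM mulrC.
by move=> s; rewrite -val_eqE /= eq_sym /pad_weight => /negPf ->; rewrite mul0r.
Qed.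

(** With [A] paddings, the weight is [1 / (L * A)]. As [L * A] is within [L] of [N], it differs from
    [1 / N] by at most [1 / (A * N)], and [A] is at least [k * L]. *)
Lemma avg_pad_weight_dist k x : (0 < k)%N -> (k * L ^ 2 <= N)%N -> (x < N)%N ->
  `|avg (fun s : 'I_L => pad_weight s x) - N%:R^-1| <= ((k * L) * N)%:R^-1.
Proof.
move=> k0 kN xN; rewrite avg_pad_weight; set A := pad_card _.
have xL : (x %% L < L)%N by rewrite ltn_pmod.
have AE := divn_eq (N - 1 - x %% L) L.
have Alt := ltn_pmod (N - 1 - x %% L) L_gt0.
have A1 : (L * A <= N + L)%N by rewrite /A /pad_card; lia.
have A2 : (N <= L * A + L)%N by rewrite /A /pad_card; lia.
(* In fact [N < L * A + L] strictly; together with [k * L * L <= N] this gives [k * L < A + 1]. *)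
have A3 : (k * L <= A)%N.
  rewrite -ltnS -(ltn_pmul2l L_gt0); apply: (@leq_trans (N + 1)); first by lia.
  by rewrite /A /pad_card; lia.
have N0 : (0 < N)%N by apply: leq_trans L_le_N.
have Lp : 0 < L%:R :> R by rewrite ltr0n.
have Ap : 0 < A%:R :> R by rewrite ltr0n.
have Np : 0 < N%:R :> R by rewrite ltr0n.
have -> : (L * A)%:R^-1 - N%:R^-1 = (N%:R - (L * A)%:R) / (L%:R * A%:R * N%:R) :> R.
  by rewrite natrM; field; rewrite !gt_eqF.
rewrite normrM normfV [X in _ / X]ger0_norm ?mulr_ge0 ?ler0n //.
have dist : `|N%:R - (L * A)%:R| <= L%:R :> R.
  rewrite ler_norml; apply/andP; split.
    by rewrite lerBrDr addrC lerBlDr -natrD ler_nat.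
  by rewrite lerBlDr -natrD ler_nat addnC.
apply: (@le_trans _ _ (L%:R / (L%:R * A%:R * N%:R))).
  by rewrite ler_wpM2r // invr_ge0 !mulr_ge0 ?ler0n.
have -> : L%:R / (L%:R * A%:R * N%:R) = (A * N)%:R^-1 :> R.
  by rewrite natrM; field; rewrite !gt_eqF.
rewrite lef_pV2 ?posrE ?ltr0n ?muln_gt0 ?k0 ?L_gt0 ?N0 //.
by rewrite ler_nat leq_mul2r A3 orbT.
Qed.

End Padding.

(** * Distance of the padded shares from uniform plaintexts *)

Section PaddedShares.
Variables (R : realType) (lam : nat) (F : gf2 lam) (n N t : nat) (s : F).
Variables (M : {set 'I_n}) (G : {ffun 'I_n -> nat} -> R).
Hypotheses (lam_gt0 : (0 < lam)%N) (n_gt0 : (0 < n)%N) (n_lt : (n < 2 ^ lam)%N).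
Hypothesis N_ge : (2 * n * 2 ^ (2 * lam) <= N)%N.
Hypothesis M_le : (#|M| <= t.-1 <= n)%N.
Hypothesis G01 : forall x, 0 <= G x <= 1.

Let L := (2 ^ lam)%N.
Let Gval (x : {ffun 'I_n -> 'I_N}) := G [ffun i => val (x i)].
Let share_weight (x : nat) : R := avg (fun s : 'I_L => pad_weight R L N s x).

Lemma share_range_gt0 : (0 < L)%N. Proof. by rewrite expn_gt0. Qed.

Lemma share_range_sqr_le : ((2 * n) * L ^ 2 <= N)%N.
Proof. by rewrite -expnM mulnC mulnC [(lam * 2)%N]mulnC. Qed.

Lemma share_range_le : (L <= N)%N.
Proof.
apply: leq_trans share_range_sqr_le; rewrite expnS expn1 mulnA leq_pmull //.
by rewrite !muln_gt0 n_gt0 share_range_gt0.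
Qed.

Lemma modulus_gt0 : (0 < N)%N.
Proof. exact: leq_trans share_range_gt0 share_range_le. Qed.

Lemma sum_unif : \sum_(x < N) N%:R^-1 = 1 :> R.
Proof.
by rewrite sumr_const card_ord -[_ *+ _]mulr_natl divff // pnatr_eq0 -lt0n
  modulus_gt0.
Qed.

Lemma avg_ffun_unif (H : {ffun 'I_n -> 'I_N} -> R) :
  avg H = \sum_(x : {ffun 'I_n -> 'I_N}) (\prod_(i < n) N%:R^-1) * H x.
Proof.
rewrite /avg card_ffun !card_ord -mulr_sumr mulrC natrX.
by rewrite prodr_const card_ord exprVn.
Qed.

Lemma avg_gf2 (H : nat -> R) :
  avg (fun x : F => H (gf_int x)) = avg (fun k : 'I_L => H k).
Proof.
rewrite [RHS](@avg_bij _ F _ (fun x => Ordinal (@gf_int_lt _ F lam_gt0 x))) //.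
exists (fun k : 'I_L => gf_of F k) => [x|k] /=; first exact: gf_intK.
by apply: val_inj; rewrite /= gf_ofK.
Qed.

(** Once padding is expressed by weights, the shares enter through the positions in [M] only. These
    are independent and uniform, so each weight is averaged separately and the secret [s]
    disappears. *)
Lemma avg_padded_shares :
  Ex (fun sh : {ffun 'I_n -> F} =>
    avg (fun a : {dffun forall i : 'I_n, 'I_((N - 1 - gf_int (sh i)) %/ L).+1} =>
      avg (fun ms : {ffun 'I_n -> 'I_N} =>
        G (mix M [ffun i => (a i * L + gf_int (sh i))%N] [ffun i => val (ms i)]))))
    (share_gen n t s) =
  \sum_(x : {ffun 'I_n -> 'I_N})
    (\prod_i (if i \in M then share_weight (x i) else N%:R^-1)) * Gval x.
Proof.
have weightsE (sh : {ffun 'I_n -> F}) :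
    avg (fun a : {dffun forall i : 'I_n, 'I_((N - 1 - gf_int (sh i)) %/ L).+1} =>
      avg (fun ms : {ffun 'I_n -> 'I_N} =>
        G (mix M [ffun i => (a i * L + gf_int (sh i))%N] [ffun i => val (ms i)]))) =
    \sum_(x : {ffun 'I_n -> 'I_N}) (\prod_(i | i \notin M) N%:R^-1 * Gval x) *
      \prod_(i in M) pad_weight R L N (gf_int (sh i)) (x i).
  rewrite (avg_pad share_range_gt0 share_range_le (fun x =>
    avg (fun ms : {ffun 'I_n -> 'I_N} =>
    G (mix M x [ffun i => val (ms i)])))); last by move=> i; apply: gf_int_lt.
  under [LHS]eq_bigr => x _.
    rewrite avg_ffun_unif.
    under [X in _ * X]eq_bigr => y _.
      rewrite (_ : G _ = Gval (mix M x y)); last first.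
        by congr G; apply/ffunP => i; rewrite /mix !ffunE; case: ifP.
      over.
    over.
  rewrite (prod_weights_mix
    (P := fun i (y : 'I_N) => pad_weight R L N (gf_int (sh i)) y)
    M (Q := fun _ _ => N%:R^-1) Gval) //; last by move=> _; apply: sum_unif.
    apply: eq_bigr => x _; rewrite (bigID (mem M)) /= [RHS]mulrC [RHS]mulrA.
    by congr (_ * _ * _); apply: eq_bigr => i; [move=> -> | move=> /negPf ->].
  by move=> i; apply: pad_weight_sum;
    [exact: share_range_gt0 | exact: share_range_le | exact: gf_int_lt].
rewrite (eq_Ex _ weightsE) Ex_sumZ; apply: eq_bigr => x _.
rewrite (share_gen_indep lam_gt0 n_lt s
  (fun i y => pad_weight R L N (gf_int y) (x i)) M_le).
rewrite mulrAC; congr (_ * _); rewrite mulrC [RHS](bigID (mem M)) /=; congr (_ * _).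
  by apply: eq_bigr => i ->; rewrite (avg_gf2 (fun k => pad_weight R L N k (x i))).
by apply: eq_bigr => i /negPf ->.
Qed.

(** With [k = 2 * n], each of at most [n * N] terms is bounded by [1 / (2 * n * L * N)], for a total
    of [1 / (2 * L)]. The bound is uniform in the secret [s]. *)
Lemma padded_shares_dist :
  `|Ex (fun sh : {ffun 'I_n -> F} =>
      avg (fun a : {dffun forall i : 'I_n, 'I_((N - 1 - gf_int (sh i)) %/ L).+1} =>
        avg (fun ms : {ffun 'I_n -> 'I_N} =>
          G (mix M [ffun i => (a i * L + gf_int (sh i))%N]
            [ffun i => val (ms i)]))))
      (share_gen n t s)
    - avg (fun ms : {ffun 'I_n -> 'I_N} => G [ffun i => val (ms i)])|
    <= (2 ^+ lam)^-1.
Proof.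
have L0 : 0 < L%:R :> R by rewrite ltr0n share_range_gt0.
have N0 : 0 < N%:R :> R by rewrite ltr0n modulus_gt0.
have n0 : 0 < n%:R :> R by rewrite ltr0n.
rewrite avg_padded_shares (avg_ffun_unif Gval).
apply: le_trans (@prod_weights_dist _ _ _
  (fun i (x : 'I_N) => if i \in M then share_weight x else N%:R^-1)
  (fun _ _ => N%:R^-1) Gval _ _ _ _ _) _ => //.
- move=> i x; case: ifP => _; last by rewrite invr_ge0 ltW.
  by rewrite divr_ge0 ?sumr_ge0 // => k _; apply: pad_weight_ge0.
- by move=> i x; rewrite invr_ge0 ltW.
- move=> i; case: (i \in M); last exact: sum_unif.
  rewrite /share_weight /avg -mulr_suml exchange_big /= (eq_bigr (fun=> 1)).
    by rewrite sumr_const divff // card_ord pnatr_eq0 -lt0n share_range_gt0.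
  by move=> k _; apply: pad_weight_sum => //;
    [exact: share_range_gt0 | exact: share_range_le].
- by move=> i; apply: sum_unif.
- by move=> x; apply: G01.
apply: (@le_trans _ _ (\sum_(i < n) \sum_(x < N) (2 * n * L * N)%:R^-1)).
  apply: ler_sum => i _; apply: ler_sum => x _; case: ifP => _; last first.
    by rewrite subrr normr0 invr_ge0 ler0n.
  apply: avg_pad_weight_dist => //; rewrite ?muln_gt0 ?n_gt0 //.
  - exact: share_range_gt0.
  - exact: share_range_le.
  - exact: share_range_sqr_le.
rewrite !sumr_const !card_ord -mulrnA -[_ *+ _]mulr_natr !natrM.
have -> : (2%:R * n%:R * L%:R * N%:R)^-1 * (N%:R * n%:R) = (2%:R * L%:R)^-1 :> R.
  by field; rewrite !gt_eqF.
rewrite -natrX -/L lef_pV2 ?posrE ?mulr_gt0 ?ltr0n ?share_range_gt0 //.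
by rewrite -natrM ler_nat leq_pmull.
Qed.

End PaddedShares.

(** * Blinding of Paillier ciphertexts *)

Section Paillier.
Variable N : nat.
Hypothesis N_gt1 : (1 < N)%N.
Local Notation Z := 'Z_(N ^ 2).

Lemma modulus_sqr_gt1 : (1 < N ^ 2)%N.
Proof. by rewrite -(exp1n 2) ltn_exp2r. Qed.

Lemma natr_sqr0 : N%:R * N%:R = 0 :> Z.
Proof. by rewrite -natrM mulnn pchar_Zp // modulus_sqr_gt1. Qed.

(** The binomial expansion stops after the linear term because the square of [N] vanishes. *)
Lemma paillier_gX k : (N.+1)%:R ^+ k = 1 + (k * N)%:R :> Z.
Proof.
elim: k => [|k IH]; first by rewrite addr0.
rewrite exprS IH -natr1 natrM mulSn natrD natrM.
have -> : (N%:R + 1) * (1 + k%:R * N%:R) =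
  1 + (N%:R + k%:R * N%:R) + k%:R * (N%:R * N%:R) :> Z by ring.
by rewrite natr_sqr0 mulr0 addr0.
Qed.

Lemma paillier_gN : (N.+1)%:R ^+ N = 1 :> Z.
Proof. by rewrite paillier_gX natrM natr_sqr0 addr0. Qed.

Lemma paillier_g_mod k : (N.+1)%:R ^+ (k %% N) = (N.+1)%:R ^+ k :> Z.
Proof.
by rewrite [in RHS](divn_eq k N) exprD mulnC exprM paillier_gN expr1n mul1r.
Qed.

Lemma paillier_g_unit : ((N.+1)%:R : Z) \is a GRing.unit.
Proof. by rewrite unitZpE ?modulus_sqr_gt1 // coprimeXl // coprimenS. Qed.

(** Adding a multiple of [N] changes the [N]th power by [N] times a multiple of [N], which is 0.
    Hence nonces may be reduced modulo [N]. *)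
Lemma natr_expN_mod k : (k %% N)%:R ^+ N = k%:R ^+ N :> Z.
Proof.
have addX (z w : Z) m : w * w = 0 ->
    (z + w) ^+ m = z ^+ m + m%:R * z ^+ m.-1 * w.
  move=> w0; elim: m => [|[|m] IH]; first by rewrite !mul0r addr0.
    by rewrite !expr1 expr0 !mul1r.
  rewrite exprS IH /=.
  have -> : (z + w) * (z ^+ m.+1 + m.+1%:R * z ^+ m * w) =
     z ^+ m.+2 + m.+2%:R * z ^+ m.+1 * w + m.+1%:R * z ^+ m * (w * w).
    by rewrite -(@natr1 _ m.+1) !exprS; ring.
  by rewrite w0 mulr0 addr0.
rewrite [in RHS](divn_eq k N) addnC natrD natrM addX.
  have -> : N%:R * (k %% N)%:R ^+ N.-1 * ((k %/ N)%:R * N%:R) =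
    (k %% N)%:R ^+ N.-1 * (k %/ N)%:R * (N%:R * N%:R) :> Z by ring.
  by rewrite natr_sqr0 mulr0 addr0.
have -> : (k %/ N)%:R * N%:R * ((k %/ N)%:R * N%:R) =
  (k %/ N)%:R ^+ 2 * (N%:R * N%:R) :> Z by ring.
by rewrite natr_sqr0 mulr0.
Qed.

Lemma modn_mulI u a b : coprime N u -> u * a = u * b %[mod N] -> a = b %[mod N].
Proof.
move=> Nu uab.
have natr_mod k m : (k%:R == m%:R :> 'Z_N) = (k == m %[mod N]).
  by rewrite -val_eqE /= !val_Zp_nat.
apply/eqP; rewrite -natr_mod; apply/eqP.
have uU : (u%:R : 'Z_N) \is a GRing.unit by rewrite unitZpE.
by apply: (mulrI uU); apply/eqP; rewrite -!natrM natr_mod; apply/eqP.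
Qed.

Lemma ltn_mod_N k : (k %% N < N)%N.
Proof. by rewrite ltn_pmod // ltnW. Qed.

Lemma nonce_coprime (r : unitZ N) : coprime N (val r).
Proof. exact: valP r. Qed.

(* Blinding by [R]: raising [g^m1 r1^N] to the power [R] and multiplying by
   [g^(x - R m2) r^N] encrypts [blind_msg] with nonce [blind_nonce]. *)
Definition blind_msg (m1 m2 x : nat) (R : 'I_N) : 'I_N :=
  Ordinal (ltn_mod_N (R * (m1 + (N - m2)) + x)).

Lemma blind_nonce_coprime (r1 : unitZ N) (R : 'I_N) (r : unitZ N) :
  coprime N (Ordinal (ltn_mod_N (val r1 ^ R * val r))).
Proof. by rewrite /= coprime_modr coprimeMr coprimeXr ?nonce_coprime. Qed.

Definition blind_nonce (r1 : unitZ N) (R : 'I_N) (r : unitZ N) : unitZ N :=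
  exist (fun r : 'I_N => coprime N r) _ (blind_nonce_coprime r1 R r).

Lemma blind_nonce_bij r1 R : bijective (blind_nonce r1 R).
Proof.
apply: injF_bij => r r' /(congr1 (fun r : unitZ N => nat_of_ord (val r))) /=.
move/modn_mulI => /(_ (coprimeXr _ (nonce_coprime r1))).
by rewrite !modn_small // => /val_inj/val_inj.
Qed.

(** The case of differing characters: a uniform [R] makes the plaintext uniform and hides [x]. The
    sum [m1 + (N - m2)] stands for [m1 - m2] modulo [N]. *)
Lemma blind_msg_bij m1 m2 x : coprime N (m1 + (N - m2)) ->
  bijective (blind_msg m1 m2 x).
Proof.
move=> cop; apply: injF_bij => R R' /(congr1 val) /= /eqP.
rewrite eqn_modDr mulnC [(R' * _)%N]mulnC => /eqP/(modn_mulI cop).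
by rewrite !modn_small // => /val_inj.
Qed.

Lemma blind_encE m1 m2 x (r1 : unitZ N) (R : 'I_N) (r : unitZ N) : (m2 <= N)%N ->
  paillier_enc N.+1 m1 r1 ^+ R
    * (N.+1)%:R ^ (- (R * m2)%N%:Z + x%:Z) * (val r : nat)%:R ^+ N
  = paillier_enc N.+1 (blind_msg m1 m2 x R) (blind_nonce r1 R r) :> Z.
Proof.
move=> m2N; rewrite /paillier_enc /= paillier_g_mod natr_expN_mod natrM natrX.
(* Since [g ^ N = 1], the negative exponent can be replaced by a natural one. *)
have gV : ((N.+1)%:R : Z) ^ (- (R * m2)%N%:Z) = (N.+1)%:R ^+ (R * (N - m2)).
  rewrite -invr_expz -exprnP; apply: (mulIr (unitrX (R * m2) paillier_g_unit)).
  rewrite mulVr ?unitrX ?paillier_g_unit //.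
  by rewrite -exprD -mulnDr subnK // mulnC exprM paillier_gN expr1n.
rewrite exprzDr ?paillier_g_unit // gV -exprnP.
rewrite exprMn -!exprM exprD mulnDr exprD exprMn -exprM.
rewrite [(m1 * R)%N]mulnC [(N * R)%N]mulnC.
by ring.
Qed.

End Paillier.

(** Two distinct numbers below a prime are not congruent modulo it, so neither [p] nor [q] divides
    the difference. *)
Lemma coprime_diff p q m1 m2 : prime p -> prime q ->
  (m1 < minn p q)%N -> (m2 < minn p q)%N -> m1 <> m2 ->
  coprime (p * q) (m1 + (p * q - m2)).
Proof.
move=> pp pq; rewrite !leq_min => /andP[m1p m1q] /andP[m2p m2q] m12.
have m2N : (m2 <= p * q)%N.
  by apply: leq_trans (ltnW m2p) _; rewrite leq_pmulr ?prime_gt0.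
have main d : (d %| p * q)%N -> (m1 < d)%N -> (m2 < d)%N ->
    ~~ (d %| m1 + (p * q - m2))%N.
  move=> dN m1d m2d; apply/negP => dvd; apply: m12.
  have : (m1 + p * q = m2 %[mod d])%N.
    by apply/eqP; rewrite eqn_mod_dvd -?addnBA // (leq_trans m2N) ?leq_addl.
  case/dvdnP: dN => k ->; rewrite addnC modnMDl !modn_small //.
by rewrite coprimeMl !prime_coprime // (main p) ?dvdn_mulr // (main q) ?dvdn_mull.
Qed.

Local Close Scope ring_scope.

(** * Secrecy *)

Lemma poly_bounded_const c : poly_bounded (fun _ => c).
Proof. by exists c, 0 => lam; rewrite leq_addl. Qed.

Lemma poly_bounded_id : poly_bounded id.
Proof. by exists 1, 1 => lam; rewrite expn1 mul1n leq_addr. Qed.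

Lemma poly_bounded_add f g :
  poly_bounded f -> poly_bounded g -> poly_bounded (fun lam => f lam + g lam).
Proof.
move=> [c [d fle]] [c' [d' gle]]; exists (c + c + (c' + c')), (d + d') => lam.
(* The [+ 1] accounts for [lam = 0], where [0 ^ 0 = 1] may face a zero power. *)
have expn_le e e' : lam ^ e <= lam ^ (e + e') + 1.
  case: lam => [|lam]; first by case: e => [|e];
    [rewrite expn0 addn1 | rewrite exp0n].
  by rewrite expnD; have := expn_gt0 lam.+1 e'; nia.
have := fle lam; have := gle lam.
have := expn_le d d'; have := expn_le d' d; rewrite [d' + d]addnC.
move: (lam ^ (d + d')) (lam ^ d) (lam ^ d') => x y z; nia.
Qed.

Lemma poly_bounded_scale k f :
  poly_bounded f -> poly_bounded (fun lam => k * f lam).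
Proof.
move=> [c [d fle]]; exists (k * c), d => lam.
by rewrite -mulnA -mulnDr leq_mul2l fle orbT.
Qed.

Section HammingScheme.
Variables (R : realType) (Sigma : finType) (n ell : nat).
Variables (toInt : Sigma -> 'I_#|Sigma|) (GF : forall lam, gf2 lam).
Variables (KG : paillier_keygen #|Sigma| n).
Variable AE : forall lam, ae_scheme (n.-tuple Sigma) lam.
Variable lam : nat.

Local Open Scope ring_scope.

Lemma ham_keygen_spec (rk : kg_coins KG lam) :
  let pk := (ham_keygen rk).2 in
  [/\ pk.2 = pk.1.+1, pk.1 = ((kg_primes rk).1 * (kg_primes rk).2)%N,
      (2 * n * 2 ^ (2 * lam) <= pk.1)%N, (#|Sigma| <= pk.1)%N
    & forall a b : 'I_#|Sigma|, a <> b -> coprime pk.1 (a + (pk.1 - b))].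
Proof.
rewrite /ham_keygen; have := kg_spec rk; case: (kg_primes rk) => p q /=.
move=> [[pp pq _] [_ Sle Nge]]; split=> // [|a b ab].
  apply: leq_trans Sle (leq_trans (geq_minl _ _) _).
  by rewrite leq_pmulr ?prime_gt0.
apply: coprime_diff => //; try exact: leq_trans (ltn_ord _) Sle.
by move=> /val_inj.
Qed.

Section Challenge.
Variable pk : nat * nat.
Hypotheses (g_def : pk.2 = pk.1.+1) (N_gt1 : (1 < pk.1)%N).
Let N := pk.1.

(** Plaintexts are natural numbers so that real challenges, with padded shares, and simulated ones
    have the same form. *)
Definition sim_ct (y : (ae_len (AE lam)).-tuple bool) (ms : {ffun 'I_n -> nat})
    (r : {ffun 'I_n -> unitZ N}) : ham_ct n N (ae_len (AE lam)) :=
  Cond [ffun i => paillier_enc N.+1 (ms i) (r i)] y.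

Lemma Ex_sim_ct (d : seq (seq bool) -> R) :
  Ex d (rbind (coin_flips (ae_len (AE lam)) [::]) (fun y =>
       rbind (iid n (paillier_sample N)) (fun mrs =>
         Ret (y :: [:: true] :: map (@paillier_wire N) mrs)))) =
  avg (fun y => avg (fun ms : {ffun 'I_n -> 'I_N} => avg (fun r =>
    d (ham_ct_wire (sim_ct y [ffun i => val (ms i)] r))))).
Proof.
rewrite Ex_bind Ex_coin_flips; apply: eq_avg => y.
rewrite Ex_bind (Ex_iid (mu := paillier_sample N)); last first.
  by move=> h; rewrite avg_pair.
transitivity (avg (fun mr : {ffun 'I_n -> 'I_N * unitZ N} =>
  d (ham_ct_wire (sim_ct y [ffun i => val (mr i).1] [ffun i => (mr i).2])))).
  rewrite [RHS]avg_tuple_ffun; apply: eq_avg => mrs /=; congr d.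
  rewrite -[in LHS](map_tnth_enum mrs) -map_comp; congr [:: _, _ & _].
  by apply: eq_map => i; rewrite /= !ffunE.
rewrite avg_ffun_pair; apply: eq_avg => ms; apply: eq_avg => r.
by congr (d (ham_ct_wire (sim_ct _ _ _))); apply/ffunP => i; rewrite !ffunE.
Qed.

Lemma Ex_run_sim (p Q : prog) (tQ b T : nat)
    (p_len : computes p b [:: nseq lam true] (nseq (ae_len (AE lam)) true))
    (Q_enc : forall (m : 'I_N) (r : unitZ N),
      computes Q tQ [:: nat_bits N; nat_bits N.+1; nat_bits m; nat_bits (val r)]
        (nat_bits (paillier_enc N.+1 m r)))
    (S := size (nat_bits N)) :
  (0 < n)%N ->
  (n * tQ + (n * (8 * S + 5) + (2 * S + 5 * lam + 5 * b + 20)) <= T)%N ->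
  halts (sim_prog p Q n) T
    (sim_store (Pi := hamming_scheme ell toInt GF KG AE) lam pk) /\
  forall d : seq (seq bool) -> R,
    Ex d (run_sim (Pi := hamming_scheme ell toInt GF KG AE)
            (sim_prog p Q n) T lam pk) =
    avg (fun y => avg (fun ms : {ffun 'I_n -> 'I_N} => avg (fun r =>
      d (ham_ct_wire (sim_ct y [ffun i => val (ms i)] r))))).
Proof.
move=> n0 /(sim_prog_spec N_gt1 Q_enc n0 p_len) sim.
rewrite /halts /run_sim /sim_store /= g_def; split.
  exact: refines_always sim.
move=> d; rewrite Ex_bind -Ex_sim_ct; apply: Ex_refines sim _.
by move=> v k s [_ <-].
Qed.

(** A change of variables from the blinding randomness to the plaintexts and nonces of the output,
    position by position. *)
Lemma Ex_condenc (m1 m2 m3 : n.-tuple Sigma) (r1 : {ffun 'I_n -> unitZ N})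
    (h : option (ham_ct n N (ae_len (AE lam))) -> R)
    (M := [set i | tnth m1 i == tnth m2 i]) :
  injective toInt -> (0 < n)%N -> (0 < lam)%N ->
  (2 * n * 2 ^ (2 * lam) <= N)%N -> (#|Sigma| <= N)%N ->
  (forall a b : 'I_#|Sigma|, a <> b -> coprime N (a + (N - b))) ->
  Ex h (ham_condenc (AE := AE) (lam := lam) (pk := pk) ell toInt GF
          (ham_enc toInt AE lam (pk := pk) m1 r1) m2 m3) =
  avg (fun K : lam.-tuple bool => avg (fun rAE : ae_coins (AE lam) =>
    Ex (fun sh : {ffun 'I_n -> GF lam} =>
      avg (fun a : {dffun forall i : 'I_n,
                      'I_((N - 1 - gf_int (sh i)) %/ 2 ^ lam).+1} =>
        avg (fun ms : {ffun 'I_n -> 'I_N} => avg (fun r =>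
          h (Some (sim_ct (ae_enc K m3 rAE)
            (mix M [ffun i => (a i * 2 ^ lam + gf_int (sh i))%N]
               [ffun i => val (ms i)]) r))))))
      (share_gen n (n - ell) (gf_of (GF lam) (int_of_key K))))).
Proof.
move=> toInt_inj n0 lam0 Nge SN Ncop.
rewrite /ham_condenc /ham_enc.
rewrite Ex_runif; apply: eq_avg => K.
rewrite Ex_runif; apply: eq_avg => rAE; rewrite [LHS]Ex_bind.
apply: eq_Ex => sh; apply: eq_avg => a.
set x := [ffun i => (a i * 2 ^ lam + gf_int (sh i))%N].
have L0 : (0 < 2 ^ lam)%N by rewrite expn_gt0.
have LN : (2 ^ lam <= N)%N := share_range_le n0 Nge.
have xN i : (x i < N)%N by rewrite ffunE; apply: pad_lt => //; apply: gf_int_lt.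
(* Where the characters agree, [R] is multiplied by [N] and the plaintext is [x] whatever its value;
   the identity serves as bijection there. *)
pose msg i (k : 'I_N) : 'I_N := if tnth m1 i == tnth m2 i then k
  else blind_msg N_gt1 (toInt (tnth m1 i)) (toInt (tnth m2 i)) (x i) k.
have msg_bij i : bijective (msg i).
  rewrite /msg; case: eqP => [_|m12]; first by exists id.
  by apply/blind_msg_bij/Ncop => /toInt_inj.
rewrite [RHS](avg_ffun_bij _ msg_bij); apply: eq_avg => Rs.
rewrite [RHS](avg_ffun_bij _ (fun i => blind_nonce_bij N_gt1 (r1 i) (Rs i))).
apply: eq_avg => r; congr (h (Some (Cond _ _))); apply/ffunP => i.
have m2N : (toInt (tnth m2 i) <= N)%N by apply: leq_trans (ltnW (ltn_ord _)) SN.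
rewrite /mix !ffunE g_def blind_encE //; congr paillier_enc.
rewrite inE /msg; case: eqP => [->|_] /=; last by rewrite ffunE.
by rewrite subnKC // modnMDl modn_small //; have := xN i; rewrite ffunE.
Qed.

End Challenge.

(** Advice is laid out right after the inputs, so hardwiring all registers but the first yields the
    very same store. *)
Lemma load_cat_advice advice (v : seq bool) (rest : seq (seq bool)) :
  load (load advice rest) [:: v] = load advice (v :: rest).
Proof.
apply: functional_extensionality => -[|i]; rewrite /load //=.
by rewrite subSS subn0; case: i.
Qed.

End HammingScheme.

Theorem theorem4 (R : realType) (Sigma : finType) (n ell : nat)
    (toInt : Sigma -> 'I_#|Sigma|) (GF : forall lam, gf2 lam)
    (KG : paillier_keygen #|Sigma| n)
    (AE : forall lam, ae_scheme (n.-tuple Sigma) lam)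
    (epsAE : nat -> nat -> R) (Q : prog) (tPEnc : nat -> nat) :
  ell < n ->
  bijective toInt ->
  unary_poly_time (fun lam => ae_len (AE lam)) ->
  paillier_enc_time KG Q tPEnc ->
  (forall tAE lam, ae_secure (AE lam) tAE (epsAE tAE lam)) ->
  exists ovh : nat -> nat, poly_bounded ovh /\
    forall t : nat -> nat,
      cond_enc_secrecy (Pi := hamming_scheme ell toInt GF KG AE)
        (P_Ham ell) t
        (fun lam => n * tPEnc lam + ovh lam)
        (fun T lam => (epsAE T lam + (2 ^+ lam)^-1)%R).
Proof.
move=> ell_n toInt_bij [p [b [b_poly p_len]]] Q_enc AE_sec.
have [S [S_poly S_le]] := kg_size KG.
have n0 : 0 < n by apply: leq_trans ell_n.
pose Sim := sim_prog p Q n.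
(* The program text counts as well, since the bound on the simulator covers both its size and its
   running time. *)
exists (fun lam => prog_size Sim +
  (n * (8 * S lam + 5) + (2 * S lam + 5 * lam + 5 * b lam + 20))); split.
  apply: poly_bounded_add (poly_bounded_const _) _.
  apply: poly_bounded_add.
    apply: poly_bounded_scale; apply: poly_bounded_add (poly_bounded_const _).
    exact: poly_bounded_scale.
  apply: poly_bounded_add (poly_bounded_const _).
  apply: poly_bounded_add; last exact: poly_bounded_scale.
  apply: poly_bounded_add; first exact: poly_bounded_scale.
  exact: poly_bounded_scale poly_bounded_id.
move=> t; exists Sim => lam n_lt; rewrite /= in n_lt; split; first by lia.
(* The properties of [gf2] are available for positive [lam] only. *)
have lam0 : 0 < lam by move: n_lt; case: (lam) => //; rewrite expn0 ltnS leqNgt n0.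
set T := _ + _.
have simE (rk : kg_coins KG lam) : let pk := (ham_keygen rk).2 in
    halts Sim T (sim_store (Pi := hamming_scheme ell toInt GF KG AE) lam pk) /\
    forall d : seq (seq bool) -> R,
      Ex d (run_sim (Pi := hamming_scheme ell toInt GF KG AE) Sim T lam pk) =
      avg (fun y => avg (fun ms : {ffun 'I_n -> 'I_pk.1} =>
        avg (fun r : {ffun 'I_n -> unitZ pk.1} => d (ham_ct_wire (sim_ct
          (AE := AE) (lam := lam) y [ffun i => val (ms i)] r))))).
  have [g_def N_def N_ge _ _] := ham_keygen_spec rk.
  have N_gt1 : 1 < (ham_keygen rk).2.1.
    by apply: leq_trans N_ge; have := expn_gt0 2 (2 * lam); nia.
  move=> pk; apply: (Ex_run_sim _ _ _ _ _ g_def N_gt1 (p_len lam)) => //.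
    by move=> m r; have := Q_enc lam rk m r; rewrite /= g_def; apply.
  rewrite leq_add2l; apply: leq_trans (leq_addl _ _).
  have := S_le lam rk; rewrite -N_def -/pk => S_pk.
  by rewrite leq_add ?leq_mul2l ?orbT //; lia.
split=> [rk|]; first by have [] := simE rk.
move=> m1 m2 m3 m12 rk r1 D D_time; cbv zeta.
set sk := (ce_keygen rk).1; set pk := (ce_keygen rk).2; set c1 := ce_enc lam m1 r1.
have [g_def _ N_ge S_le_N N_cop] := ham_keygen_spec rk.
have N_gt1 : 1 < (ham_keygen rk).2.1.
  by apply: leq_trans N_ge; have := expn_gt0 2 (2 * lam); nia.
rewrite -/pk in g_def N_ge S_le_N N_cop N_gt1.
have [_ simEd] := simE rk; rewrite !prob_bind simEd.
pose W (y : (ae_len (AE lam)).-tuple bool) ms r : R := prob R id (run_dist D (t lam)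
  (ce_view (Pi := hamming_scheme ell toInt GF KG AE) sk m1 m2 m3 c1
    (ham_ct_wire (sim_ct (pk := pk) y ms r)))).
pose V y := avg (fun ms : {ffun 'I_n -> 'I_pk.1} =>
  avg (W y [ffun i => val (ms i)])).
rewrite -[avg (fun y => _)]/(avg V).
rewrite [X in (_ - X)%R](Ex_condenc ell GF g_def N_gt1 m1 m2 m3 r1
  _ (bij_inj toInt_bij) n0 lam0 N_ge S_le_N N_cop).
(* The intermediate experiment: uniform plaintexts as in the simulation, but a genuine authenticated
   encryption under an independent key. *)
pose hyb := avg (fun K : lam.-tuple bool => avg (fun rAE : ae_coins (AE lam) =>
  V (ae_enc K m3 rAE))).
have tuple_gt0 : 0 < #|{:lam.-tuple bool}| by rewrite card_tuple expn_gt0 card_bool.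
apply: (le_trans (ler_distD hyb _ _)); apply: lerD.
  (* Plaintexts and nonces are averaged outermost, so that they can be fixed and hardwired into the
     distinguisher. *)
  have Vexch (X : finType) (e : X -> (ae_len (AE lam)).-tuple bool) :
      avg (fun x => V (e x)) = avg (fun ms : {ffun 'I_n -> 'I_pk.1} =>
        avg (fun r => avg (fun x => W (e x) [ffun i => val (ms i)] r))).
    rewrite avg_exchange; apply: eq_avg => ms; exact: avg_exchange.
  have -> : hyb = avg (fun Kr : lam.-tuple bool * ae_coins (AE lam) =>
      V (ae_enc Kr.1 m3 Kr.2)) by rewrite avg_pair.
  rewrite (Vexch _ id) Vexch.
  apply: avg_dist => [|ms].
    by rewrite card_ffun !card_ord expn_gt0 (ltnW N_gt1).
  apply: avg_dist => [|r].
    by rewrite card_ffun expn_gt0 card_unitZ_gt0 // ltnW.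
  pose v (y : (ae_len (AE lam)).-tuple bool) :=
    ce_view (Pi := hamming_scheme ell toInt GF KG AE) sk m1 m2 m3 c1
    (ham_ct_wire (sim_ct (pk := pk) y [ffun i => val (ms i)] r)).
  (* The all-true string is a placeholder: [behead] removes the only register in which it occurs. *)
  pose D' : distinguisher :=
    (D.1, load D.2 (behead (v (@nseq_tuple (ae_len (AE lam)) bool true)))).
  have runD' y : run_dist D' (t lam) [:: tval y] = run_dist D (t lam) (v y).
    by rewrite /run_dist load_cat_advice.
  have D'_time : time_bounded D' (t lam)
      (fun u => exists c : (ae_len (AE lam)).-tuple bool, u = [:: tval c]).
    case: D_time => D_size D_halts; split=> // _ [y ->].
    rewrite load_cat_advice; apply: (D_halts (v y)).
    by exists rk, m1, m2, m3, c1, (sim_ct (pk := pk) y [ffun i => val (ms i)] r).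
  have := AE_sec (t lam) lam m3 D' D'_time; rewrite distrC.
  congr (`|_ - _| <= _)%R.
    by rewrite prob_bind; apply: eq_avg => y /=; rewrite /W -runD'.
  rewrite avg_pair prob_bind; apply: eq_avg => K.
  by rewrite prob_bind; apply: eq_avg => rAE /=; rewrite /W -runD'.
(* The key and the coins of the payload encryption are fixed here, the bound on the shares being
   valid for every secret. *)
apply: avg_dist => // K; apply: avg_dist => [|rAE]; first exact: ae_coins_gt0.
rewrite distrC.
apply: (padded_shares_dist _ (G := fun x => avg (W (ae_enc K m3 rAE) x))
  lam0 n0 n_lt N_ge).
  (* More than [ell] positions differ, so at most [n - ell - 1] agree, one less than the sharing
     threshold. *)
  rewrite (leq_trans (leq_pred _)) ?leq_subr // andbT.
  have : #|[set i | tnth m1 i == tnth m2 i]| + Ham m1 m2 = n.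
    have := cardsC [set i | tnth m1 i == tnth m2 i]; rewrite card_ord => cardM.
    by rewrite -[RHS]cardM; congr (_ + #|pred_of_set _|);
      apply/setP => i; rewrite !inE.
  move: m12 => /negbT; rewrite /P_Ham -ltnNge; move: (Ham _ _) => h.
  by move: #|_| => m; lia.
by move=> x; apply: avg_itv => r; apply: prob_itv.
Qed.
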